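(* Let $\Phi$ be a polynomial time computable implicit set system, let $I$ be an instance with $\Phi(I)=(U,\mathcal F)$ and $|U|=n$, and let $\alpha\in[0,1]$. There is an algorithm running in $O^*(s(n,\alpha))$ time, where $s(n,\alpha)=\sum_{i=0}^{\lfloor\alpha n\rfloor}\binom{n}{i}$, which determines, for every integer $k\le \alpha n$ and every subset $X\subseteq U$ with $|X|\le \alpha n$, whether $X$ has a $k$-cover (under the assumption that $\mathcal F$ is closed under taking subsets), whether $X$ has a $k$-partition, and whether $X$ has a $k$-packing, with sets from $\mathcal F$.
   Context: An implicit set system is a function $\Phi$ mapping a string $I\in\{0,1\}^*$ (an instance) to a set system $(U_I,\mathcal F_I)$, where $\mathcal F_I$ is a collection of subsets of the universe $U_I$. It is polynomial time computable if there is a polynomial time algorithm producing $U_I$ from $I$, and a polynomial time algorithm that, given $I$, $U_I$ and $S\subseteq U_I$, decides whether $S\in\mathcal F_I$. For $X\subseteq U$, an ordered tuple $(S_1,\dots,S_k)$ of sets from $\mathcal F$ is a $k$-cover for $X$ if $S_1\cup\dots\cup S_k=X$; a $k$-packing for $X$ if all $S_i\subseteq X$ and they are pairwise disjoint; a $k$-partition for $X$ if it is both a $k$-cover and a $k$-packing for $X$. $O^*$ hides factors polynomial in the instance size $|I|$ (with $|I|\ge n$). *)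

(* Defs.v *)
From HB Require Import structures.
From mathcomp Require Import all_boot all_order all_algebra finmap.
From mathcomp Require Import reals.

Set Implicit Arguments.
Unset Strict Implicit.
Unset Printing Implicit Defensive.

Import Order.TTheory GRing.Theory Num.Theory.

Local Open Scope fset_scope.

Definition bitstring := seq bool.

(* Universe elements are named by bit strings, so that they can be handled by
   algorithms. *)
Record set_system := SetSystem {
  ground : {fset bitstring};
  members : {fset {fset bitstring}};
  members_sub : forall S, S \in members -> S `<=` ground }.

Definition implicit_set_system := bitstring -> set_system.

Section Tuples.
Variables (F : {fset {fset bitstring}}) (k : nat) (X : {fset bitstring}).
Implicit Type T : k.-tuple {fset bitstring}.

Definition tuple_from T := forall i : 'I_k, tnth T i \in F.

Definition is_cover T := tuple_from T /\ \big[@fsetU _/fset0]_(i < k) tnth T i = X.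

Definition is_packing T :=
  [/\ tuple_from T,
      forall i : 'I_k, tnth T i `<=` X &
      forall i j : 'I_k, i != j -> [disjoint tnth T i & tnth T j]%fset].

Definition is_partition T := is_cover T /\ is_packing T.

Definition has_cover := exists T, is_cover T.
Definition has_packing := exists T, is_packing T.
Definition has_partition := exists T, is_partition T.
End Tuples.

Definition closed_under_subsets (F : {fset {fset bitstring}}) :=
  forall A B : {fset bitstring}, A \in F -> B `<=` A -> B \in F.

(* Model of computation: N. D. Jones's WHILE language ("Computability and Complexity from a
  Programming Perspective", 1997): imperative programs over binary trees with
  unit-cost [cons], [hd], [tl] and nil-tests, plus a primitive conditional.
  A program running in time t is executed by a pointer machine, or a RAM with
  O(log t)-bit words, in O(t) steps, trees being immutable linked cells;
  polynomial time in this model is the usual class P. *)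

Inductive tree := Nil | Cons of tree & tree.

Fixpoint tree_size (d : tree) : nat :=
  if d is Cons a b then (tree_size a + tree_size b).+1 else 1.

Definition hd (d : tree) : tree := if d is Cons a _ then a else Nil.
Definition tl (d : tree) : tree := if d is Cons _ b then b else Nil.
Definition is_nil (d : tree) : bool := if d is Nil then true else false.

Inductive expr :=
  | EVar of nat
  | ENil
  | ECons of expr & expr
  | EHd of expr
  | ETl of expr.

Inductive cmd :=
  | Assign of nat & expr
  | Seq of cmd & cmd
  | If of expr & cmd & cmd
  | While of expr & cmd.

Definition store := nat -> tree.

Definition update (s : store) (x : nat) (d : tree) : store :=
  fun y => if y == x then d else s y.

Fixpoint eval (s : store) (e : expr) : tree :=
  match e with
  | EVar x => s x
  | ENil => Nil
  | ECons e1 e2 => Cons (eval s e1) (eval s e2)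
  | EHd e1 => hd (eval s e1)
  | ETl e1 => tl (eval s e1)
  end.

Fixpoint expr_cost (e : expr) : nat :=
  match e with
  | EVar _ | ENil => 1
  | ECons e1 e2 => (expr_cost e1 + expr_cost e2).+1
  | EHd e1 | ETl e1 => (expr_cost e1).+1
  end.

(* [exec c s s' t]: started in store [s], [c] halts in store [s'] after [t]
   steps; nil is false, every other tree is true. *)
Inductive exec : cmd -> store -> store -> nat -> Prop :=
  | exec_assign x e s :
      exec (Assign x e) s (update s x (eval s e)) (expr_cost e).+1
  | exec_seq c1 c2 s s1 s2 t1 t2 :
      exec c1 s s1 t1 -> exec c2 s1 s2 t2 ->
      exec (Seq c1 c2) s s2 (t1 + t2)
  | exec_if_true e c1 c2 s s1 t :
      ~~ is_nil (eval s e) -> exec c1 s s1 t ->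
      exec (If e c1 c2) s s1 (expr_cost e + t).+1
  | exec_if_false e c1 c2 s s1 t :
      is_nil (eval s e) -> exec c2 s s1 t ->
      exec (If e c1 c2) s s1 (expr_cost e + t).+1
  | exec_while_true e c s s1 s2 t1 t2 :
      ~~ is_nil (eval s e) -> exec c s s1 t1 -> exec (While e c) s1 s2 t2 ->
      exec (While e c) s s2 (expr_cost e + t1 + t2).+1
  | exec_while_false e c s :
      is_nil (eval s e) -> exec (While e c) s s (expr_cost e).+1.

(* Variable 0 holds the input at the start, all other variables being nil, and
   the output at the end. *)
Definition runs (P : cmd) (input output : tree) (t : nat) : Prop :=
  exists2 s, exec P (update (fun=> Nil) 0 input) s t & s 0 = output.

Definition enc_seq (T : Type) (enc : T -> tree) (s : seq T) : tree :=
  foldr (fun x d => Cons (enc x) d) Nil s.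

Definition enc_bool (b : bool) : tree := if b then Cons Nil Nil else Nil.
Definition enc_nat (n : nat) : tree := iter n (Cons Nil) Nil.
Definition enc_bits : bitstring -> tree := enc_seq enc_bool.
Definition enc_strings : seq bitstring -> tree := enc_seq enc_bits.

(* Finite sets of strings are passed to and from programs as duplicate-free
   lists, in any order. *)
Definition lists (s : seq bitstring) (A : {fset bitstring}) : Prop :=
  uniq s /\ s =i A.

Definition universe_polytime (Phi : implicit_set_system) : Prop :=
  exists (P : cmd) (p : {poly nat}), forall I : bitstring,
  exists (u : seq bitstring) (t : nat),
    [/\ lists u (ground (Phi I)),
        runs P (enc_bits I) (enc_strings u) t &
        t <= p.[tree_size (enc_bits I)]%R].

Definition enc_query (I : bitstring) (u s : seq bitstring) : tree :=
  Cons (enc_bits I) (Cons (enc_strings u) (enc_strings s)).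

Definition membership_polytime (Phi : implicit_set_system) : Prop :=
  exists (P : cmd) (p : {poly nat}),
  forall (I : bitstring) (S : {fset bitstring}) (u s : seq bitstring),
    lists u (ground (Phi I)) -> S `<=` ground (Phi I) -> lists s S ->
  exists2 t : nat,
    runs P (enc_query I u s) (enc_bool (S \in members (Phi I))) t &
    t <= p.[tree_size (enc_query I u s)]%R.

Definition polytime_computable (Phi : implicit_set_system) : Prop :=
  universe_polytime Phi /\ membership_polytime Phi.

(* The floor of [alpha * n], for [0 <= alpha]. *)
Definition threshold (R : realType) (n : nat) (alpha : R) : nat :=
  Num.truncn (alpha * n%:R)%R.

Definition binomial_sum (R : realType) (n : nat) (alpha : R) : nat :=
  \sum_(0 <= i < (threshold n alpha).+1) 'C(n, i).

(* A real [alpha] has no finite encoding; a program receives it through the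
   integer [threshold n alpha]. *)
Definition enc_input (I : bitstring) (m : nat) : tree :=
  Cons (enc_bits I) (enc_nat m).

(* A row [(k, x, cover, partition, packing)] of the output table holds the three
   answers for [k] sets and the subset listed by [x]. *)
Definition table_row : eqType := (nat * seq bitstring * bool * bool * bool)%type.

Definition enc_row (r : table_row) : tree :=
  let: (k, x, cover, partition, packing) := r in
  Cons (enc_nat k) (Cons (enc_strings x)
    (Cons (enc_bool cover) (Cons (enc_bool partition) (enc_bool packing)))).

Definition enc_table : seq table_row -> tree := enc_seq enc_row.

Definition row_about (k : nat) (X : {fset bitstring}) (r : table_row) : Prop :=
  let: (k', x, _, _, _) := r in k' = k /\ lists x X.

Definition row_correct (F : {fset {fset bitstring}}) (k : nat)
    (X : {fset bitstring}) (r : table_row) : Prop :=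
  let: (_, _, cover, partition, packing) := r in
  [/\ closed_under_subsets F -> (cover <-> has_cover F k X),
      partition <-> has_partition F k X &
      packing <-> has_packing F k X].

Definition table_determines (F : {fset {fset bitstring}}) (k : nat)
    (X : {fset bitstring}) (T : seq table_row) : Prop :=
  (exists2 r, r \in T & row_about k X r) /\
  (forall r, r \in T -> row_about k X r -> row_correct F k X r).

(* Main.v *)
Require Import Defs.
From mathcomp Require Import all_boot all_order all_algebra finmap zify ring.
From mathcomp Require Import reals.
Import Defs.

(* Removing from each set of a cover the elements already covered shows that,
   when [F] is closed under subsets, covers and partitions exist together; and
   [X] has a packing iff some subset of [X] has a partition.  So it suffices to
   decide partitions, and to close the answers under supersets.

   Give [S] in [F] the weight [q ^ |S|] with [q = 2 ^ B].  The zeta transform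
   [h] of this weight function is computed by one pass over the sets of size at
   most [m] per element of the universe, and the Moebius transform of [h ^ k]
   at [X] is the total weight of the [k]-covers of [X].  A cover has weight at
   least [q ^ |X|], with equality exactly for partitions, so modulo
   [q ^ (|X| + 1)] this total is [q ^ |X|] times the number of [k]-partitions,
   which is less than [q] when [B = (n + 1) ^ 2].  All arithmetic is done modulo
   [2 ^ L] with [L = B (n + 1)].

   The tables are tries over the bit masks of the small subsets, so that a
   transform is a recursion over a trie. *)

(** Restricting the transforms to small sets loses nothing, because the value of a transform at [X]
    involves only subsets of [X]; this is what keeps the work at the number of small sets, up to
    polynomial factors. The constants arise as follows. In a partition each of at most [n] elements
    chooses among [k] sets, and the crude bound [2 ^ (n k)] with [k <= m <= n] stays below [2 ^ B].
    The answer at [X] is read off modulo [2 ^ (B (|X| + 1))], a divisor of [2 ^ L] since [|X| <= n].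
    A fixed width [L] also bounds the cost of every operation, and gives signs for free: the string
    of ones is -1. Two obstacles come from the model. It has neither procedures nor random access,
    so recursion is run by an interpreter with explicit stacks whose cost is tracked. And the
    membership program is fed names printed by the universe program, which must be shown to be
    short. *)

Set Implicit Arguments.
Unset Strict Implicit.
Unset Printing Implicit Defensive.

(** * Programs with a single tree argument *)

(* A program is parametrised by a base register [b]: it finds its argument
   in [b], leaves its result there, and may use every register above [b]. *)
Definition prog := nat -> cmd.

(** The last clause is what makes programs compose: a caller keeps its live data below the base it
    hands to the callee. Nothing is assumed about the registers above the base, which may hold
    leftovers. *)
Definition run (p : prog) (x y : tree) (t : nat) : Prop :=
  forall b s, s b = x -> exists s' t',
    [/\ exec (p b) s s' t', t' <= t, s' b = y & forall i, i < b -> s' i = s i].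

Lemma run_le p x y t t' : run p x y t -> t <= t' -> run p x y t'.
Proof.
move=> H le b s /H [s' [t1 [e l v f]]]; exists s', t1; split=> //; lia.
Qed.

(* In program expressions [EVar i] is the [i]-th entry of the argument, read
   as a list. *)
Fixpoint place (b : nat) (e : expr) : expr :=
  match e with
  | EVar i => EHd (iter i ETl (EVar b))
  | ENil => ENil
  | ECons e1 e2 => ECons (place b e1) (place b e2)
  | EHd e1 => EHd (place b e1)
  | ETl e1 => ETl (place b e1)
  end.

Fixpoint denote (x : tree) (e : expr) : tree :=
  match e with
  | EVar i => hd (iter i tl x)
  | ENil => Nil
  | ECons e1 e2 => Cons (denote x e1) (denote x e2)
  | EHd e1 => hd (denote x e1)
  | ETl e1 => tl (denote x e1)
  end.

Fixpoint weight (e : expr) : nat :=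
  match e with
  | EVar i => i.+2
  | ENil => 1
  | ECons e1 e2 => (weight e1 + weight e2).+1
  | EHd e1 | ETl e1 => (weight e1).+1
  end.

Lemma eval_place s b e : eval s (place b e) = denote (s b) e.
Proof.
elim: e => //= [i|e1 -> e2 ->|e1 ->|e1 ->] //; congr hd.
by elim: i => //= i ->.
Qed.

Lemma cost_place b e : expr_cost (place b e) = weight e.
Proof.
elim: e => //= [i|e1 -> e2 ->|e1 ->|e1 ->] //; congr _.+1.
by elim: i => //= i ->.
Qed.

Lemma update_eq s x d : update s x d x = d.
Proof. by rewrite /update eqxx. Qed.

Lemma update_neq s x d y : y != x -> update s x d y = s y.
Proof. by rewrite /update => /negbTE ->. Qed.

Definition pret (e : expr) : prog := fun b => Assign b (place b e).

Definition pthen (p q : prog) : prog := fun b => Seq (p b) (q b).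

Definition pcall (e : expr) (p : prog) : prog := pthen (pret e) p.

(** [p] runs one register up so that the argument survives in [b]; the result is then consed onto
    it. Entries thus behave as de Bruijn indices: each [plet] shifts the older ones by one. *)
Definition plet (p q : prog) : prog := fun b =>
  Seq (Assign b.+1 (EVar b))
    (Seq (p b.+1) (Seq (Assign b (ECons (EVar b.+1) (EVar b))) (q b))).

Definition pif (e : expr) (p q : prog) : prog := fun b =>
  If (place b e) (p b) (q b).

Lemma run_ret e x : run (pret e) x (denote x e) (weight e).+1.
Proof.
move=> b s sb; exists (update s b (denote x e)), (weight e).+1; split=> //.
- by rewrite -sb -eval_place -(cost_place b); apply: exec_assign.
- by rewrite update_eq.
- by move=> i ib; rewrite update_neq //; lia.
Qed.

Lemma run_then p q x y z t1 t2 :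
  run p x y t1 -> run q y z t2 -> run (pthen p q) x z (t1 + t2).
Proof.
move=> H1 H2 b s /H1 [s1 [t1' [e1 l1 /H2 [s2 [t2' [e2 l2 v2 f2]]] f1]]].
exists s2, (t1' + t2'); split=> //; [exact: exec_seq e1 e2|lia|].
by move=> i ib; rewrite f2 // f1.
Qed.

Lemma run_call e p x y t :
  run p (denote x e) y t -> run (pcall e p) x y ((weight e).+1 + t).
Proof. by apply: run_then; apply: run_ret. Qed.

Lemma run_let p q x y z t1 t2 :
  run p x y t1 -> run q (Cons y x) z t2 ->
  run (plet p q) x z (t1 + t2 + 6).
Proof.
move=> H1 H2 b s sb.
have [|s1 [t1' [e1 l1 v1 f1]]] := H1 b.+1 (update s b.+1 (s b)).
  by rewrite update_eq.
have s1b : s1 b = x by rewrite f1 // update_neq //; lia.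
have [|s2 [t2' [e2 l2 v2 f2]]] := H2 b (update s1 b (Cons y x)).
  by rewrite update_eq.
exists s2, (2 + (t1' + (4 + t2'))); split=> //; [|lia|].
- apply: exec_seq (exec_assign _ _ _) _; apply: exec_seq e1 _.
  have := exec_assign b (ECons (EVar b.+1) (EVar b)) s1.
  by rewrite /= v1 s1b => /exec_seq; apply.
- move=> i ib; rewrite f2 // update_neq; last lia.
  by rewrite f1; [rewrite update_neq //; lia|lia].
Qed.

Lemma run_if_true e p q x y t :
  ~~ is_nil (denote x e) -> run p x y t -> run (pif e p q) x y (t + weight e).+1.
Proof.
move=> ne H b s sb; have [s' [t' [ex l v f]]] := H b s sb.
exists s', (weight e + t').+1; split=> //; last lia.
by rewrite -(cost_place b); apply: exec_if_true; rewrite // eval_place sb.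
Qed.

Lemma run_if_false e p q x y t :
  is_nil (denote x e) -> run q x y t -> run (pif e p q) x y (t + weight e).+1.
Proof.
move=> ne H b s sb; have [s' [t' [ex l v f]]] := H b s sb.
exists s', (weight e + t').+1; split=> //; last lia.
by rewrite -(cost_place b); apply: exec_if_false; rewrite // eval_place sb.
Qed.

(** * Recursion *)

(* A task is a value, a call, or a node that combines the results of two
   subtasks; [KTask] is the frame left on the stack by a node. *)
Definition VTask v := Cons Nil v.
Definition CTask x := Cons (enc_nat 1) x.
Definition NTask ctx a b := Cons (enc_nat 2) (Cons ctx (Cons a b)).
Definition KTask ctx := Cons (enc_nat 3) ctx.

Fixpoint enat (n : nat) : expr := if n is n'.+1 then ECons ENil (enat n') else ENil.
Definition EV e := ECons ENil e.
Definition EC e := ECons (enat 1) e.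
Definition EN ctx a b := ECons (enat 2) (ECons ctx (ECons a b)).

(** The result of a call is itself a task, which covers tail calls. The constants over-estimate the
    interpreter below: a node takes 52 steps to expand and 48 to close its frame. *)
Inductive task (st cb : prog) : tree -> tree -> nat -> Prop :=
  | task_val v : task st cb (VTask v) v 50
  | task_call x a y t t' :
      run st x a t -> task st cb a y t' -> task st cb (CTask x) y (t + t' + 50)
  | task_node ctx a b y1 y2 y t1 t2 t3 :
      task st cb a y1 t1 -> task st cb b y2 t2 ->
      run cb (Cons y1 (Cons y2 ctx)) y t3 ->
      task st cb (NTask ctx a b) y (t1 + t2 + t3 + 100)
  | task_le a y t t' : task st cb a y t -> t <= t' -> task st cb a y t'.

(** Register [b] is the stack of pending tasks, [b.+1] the stack of results, and [b.+2] is scratch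
    space and the base for [st] and [cb]. The unary tag of the task selects the branch. When a frame
    is reached, the second result lies on top of the first. *)
Definition prec_body (st cb : prog) (b : nat) : cmd :=
  let T := EVar b in let V := EVar b.+1 in let W := EVar b.+2 in
  Seq (Assign b.+2 (EHd T))
 (Seq (Assign b (ETl T))
  (If (EHd W)
   (If (ETl (EHd W))
    (If (ETl (ETl (EHd W)))
      (Seq (Assign b.+2 (ECons (EHd (ETl V)) (ECons (EHd V) (ETl W))))
       (Seq (cb b.+2) (Assign b.+1 (ECons W (ETl (ETl V))))))
      (Assign b (ECons (EHd (ETl (ETl W))) (ECons (ETl (ETl (ETl W)))
                  (ECons (ECons (enat 3) (EHd (ETl W))) T)))))
    (Seq (Assign b.+2 (ETl W)) (Seq (st b.+2) (Assign b (ECons W T)))))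
   (Assign b.+1 (ECons (ETl W) V)))).

Definition prec (st cb : prog) : prog := fun b =>
  Seq (Assign b (ECons (ECons (enat 1) (EVar b)) ENil))
 (Seq (Assign b.+1 ENil)
 (Seq (While (EVar b) (prec_body st cb b))
  (Assign b (EHd (EVar b.+1))))).

Section Recursion.
Variables (st cb : prog) (b : nat) (s0 : store).

Let loop := While (EVar b) (prec_body st cb b).

Let config (T V : tree) (s : store) :=
  [/\ s b = T, s b.+1 = V & forall i, i < b -> s i = s0 i].

(** Speaks of all the remaining iterations at once, so that the step lemmas chain backwards from the
    final configuration, with arbitrary stacks below the current task. *)
Let finishes (T V y : tree) (t : nat) :=
  forall s, config T V s -> exists s' t', [/\ exec loop s s' t', t' <= t,
    s' b.+1 = y & forall i, i < b -> s' i = s0 i].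

Let step T V T' V' y t t' :
  ~~ is_nil T ->
  (forall s, config T V s -> exists s' t1, [/\ exec (prec_body st cb b) s s' t1,
     t1 <= t & config T' V' s']) ->
  finishes T' V' y t' -> finishes T V y (t + t' + 2).
Proof.
move=> nT H1 H2 s c; have [s1 [t1 [e1 l1 /H2 [s2 [t2 [e2 l2 v2 f2]]]]]] := H1 s c.
exists s2, (1 + t1 + t2).+1; split=> //; last lia.
by apply: exec_while_true e1 e2; case: c => /= ->.
Qed.

Let upd := (update_eq, fun s d => @update_neq s b d b.+1 (ltac:(lia)),
  fun s d => @update_neq s b d b.+2 (ltac:(lia)),
  fun s d => @update_neq s b.+1 d b (ltac:(lia)),
  fun s d => @update_neq s b.+1 d b.+2 (ltac:(lia)),
  fun s d => @update_neq s b.+2 d b (ltac:(lia)),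
  fun s d => @update_neq s b.+2 d b.+1 (ltac:(lia))).

Let popped (s : store) : store :=
  update (update s b.+2 (hd (s b))) b (tl (s b)).

Let exec_pop c s s' t : exec c (popped s) s' t ->
  exec (Seq (Assign b.+2 (EHd (EVar b))) (Seq (Assign b (ETl (EVar b))) c)) s s'
    (3 + (3 + t)).
Proof.
move=> e; apply: exec_seq (exec_assign _ _ _) _ => /=.
have := exec_assign b (ETl (EVar b)) (update s b.+2 (hd (s b))).
by rewrite /= !upd => /exec_seq; apply.
Qed.

Let popped_top s a r : s b = Cons a r -> popped s b.+2 = a.
Proof. by rewrite /popped !upd => ->. Qed.

Let popped_rest s a r : s b = Cons a r -> popped s b = r.
Proof. by rewrite /popped !upd => ->. Qed.

Let popped_vals s : popped s b.+1 = s b.+1.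
Proof. by rewrite /popped !upd. Qed.

Let popped_low s i : i < b -> popped s i = s i.
Proof. by move=> ib; rewrite /popped ?update_neq //; lia. Qed.

Let finishes_val v T V y t :
  finishes T (Cons v V) y t -> finishes (Cons (VTask v) T) V y (30 + t).
Proof.
move=> H; suff: finishes (Cons (VTask v) T) V y (20 + t + 2).
  by move=> H' s /H' [s' [t' [? ? ? ?]]]; exists s', t'; split=> //; lia.
apply: step H => // s [sb sV f].
eexists _, _; split.
- apply: exec_pop; apply: exec_if_false => /=; last exact: exec_assign.
  by rewrite (popped_top sb).
- by [].
- rewrite /= (popped_top sb) popped_vals sV /=; split.
  + by rewrite !upd (popped_rest sb).
  + by rewrite !upd.
  + by move=> i ib; rewrite update_neq ?popped_low ?f //; lia.
Qed.

Let finishes_node ctx a1 a2 T V y t :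
  finishes (Cons a1 (Cons a2 (Cons (KTask ctx) T))) V y t ->
  finishes (Cons (NTask ctx a1 a2) T) V y (52 + t).
Proof.
move=> H; suff: finishes (Cons (NTask ctx a1 a2) T) V y (50 + t + 2).
  by move=> H' s /H' [s' [t' [? ? ? ?]]]; exists s', t'; split=> //; lia.
apply: step H => // s [sb sV f].
eexists _, _; split.
- apply: exec_pop; apply: exec_if_true => /=; first by rewrite (popped_top sb).
  apply: exec_if_true => /=; first by rewrite (popped_top sb).
  apply: exec_if_false => /=; first by rewrite (popped_top sb).
  exact: exec_assign.
- by [].
- rewrite /= (popped_top sb) (popped_rest sb) /=; split.
  + by rewrite !upd.
  + by rewrite !upd popped_vals.
  + by move=> i ib; rewrite update_neq ?popped_low ?f //; lia.
Qed.

Let finishes_call x a T V y t t' : run st x a t ->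
  finishes (Cons a T) V y t' -> finishes (Cons (CTask x) T) V y (t + t' + 30).
Proof.
move=> H1 H; suff: finishes (Cons (CTask x) T) V y (t + 28 + t' + 2).
  by move=> H' s /H' [s' [u [? ? ? ?]]]; exists s', u; split=> //; lia.
apply: step H => // s [sb sV f].
have [|s1 [t1 [e1 l1 v1 f1]]] := H1 b.+2 (update (popped s) b.+2 x).
  by rewrite update_eq.
eexists _, _; split.
- apply: exec_pop; apply: exec_if_true => /=; first by rewrite (popped_top sb).
  apply: exec_if_false => /=; first by rewrite (popped_top sb).
  apply: exec_seq (exec_assign _ _ _) _; rewrite /= (popped_top sb) /=.
  apply: exec_seq e1 _; exact: exec_assign.
- by rewrite /=; lia.
- rewrite /= v1 f1 //; split.
  + by rewrite !upd (popped_rest sb).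
  + by rewrite !upd f1 // !upd popped_vals.
  + by move=> i ib; rewrite update_neq ?f1 ?update_neq ?popped_low ?f //; lia.
Qed.

Let finishes_frame ctx y1 y2 z T V y t t' :
  run cb (Cons y1 (Cons y2 ctx)) z t ->
  finishes T (Cons z V) y t' ->
  finishes (Cons (KTask ctx) T) (Cons y2 (Cons y1 V)) y (t + t' + 48).
Proof.
move=> H1 H.
suff: finishes (Cons (KTask ctx) T) (Cons y2 (Cons y1 V)) y (t + 46 + t' + 2).
  by move=> H' s /H' [s' [u [? ? ? ?]]]; exists s', u; split=> //; lia.
apply: step H => // s [sb sV f].
have [|s1 [t1 [e1 l1 v1 f1]]] :=
    H1 b.+2 (update (popped s) b.+2 (Cons y1 (Cons y2 ctx))).
  by rewrite update_eq.
eexists _, _; split.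
- apply: exec_pop; apply: exec_if_true => /=; first by rewrite (popped_top sb).
  apply: exec_if_true => /=; first by rewrite (popped_top sb).
  apply: exec_if_true => /=; first by rewrite (popped_top sb).
  apply: exec_seq (exec_assign _ _ _) _.
  rewrite /= (popped_top sb) popped_vals sV /=.
  apply: exec_seq e1 _; exact: exec_assign.
- by rewrite /=; lia.
- rewrite /= v1 f1 // !upd popped_vals sV; split.
  + by rewrite !upd f1 // !upd (popped_rest sb).
  + by rewrite !upd.
  + by move=> i ib; rewrite update_neq ?f1 ?update_neq ?popped_low ?f //; lia.
Qed.

Let finishes_le T V y t t' : finishes T V y t -> t <= t' -> finishes T V y t'.
Proof.
move=> H le s /H [s' [u [? ? ? ?]]]; exists s', u; split=> //; lia.
Qed.

Let finishes_task a y t : task st cb a y t ->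
  forall T V z t', finishes T (Cons y V) z t' -> finishes (Cons a T) V z (t + t').
Proof.
elim=> {a y t} [v|x a y t u H _ IH|ctx a1 a2 y1 y2 y t1 t2 t3 _ IH1 _ IH2 H|
    a y t u _ IH le] T V z t' F.
- by apply: finishes_le (finishes_val F) _; lia.
- by apply: finishes_le (finishes_call H (IH _ _ _ _ F)) _; lia.
- apply: finishes_le; first apply: finishes_node.
    apply: IH1; apply: IH2; apply: finishes_frame H F.
  by lia.
- by apply: finishes_le (IH _ _ _ _ F) _; lia.
Qed.

Lemma exec_rec x y t s : task st cb (CTask x) y t -> s b = x ->
  (forall i, i < b -> s i = s0 i) ->
  exists s' t', [/\ exec (prec st cb b) s s' t', t' <= t + 20, s' b = y &
    forall i, i < b -> s' i = s0 i].
Proof.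
move=> /finishes_task F sb f.
have /F {}F : finishes Nil (Cons y Nil) (Cons y Nil) 2.
  move=> s1 [h1 h2 h3]; exists s1, 2; split=> //.
  by apply: exec_while_false; rewrite /= h1.
pose s1 := update (update s b (Cons (CTask x) Nil)) b.+1 Nil.
have [|s2 [t2 [e2 l2 v2 f2]]] := F s1.
  split; rewrite /s1 ?upd //.
  by move=> i ib; rewrite !update_neq ?f //; lia.
eexists _, _; split.
- apply: exec_seq (exec_assign _ _ _) _; rewrite /= sb.
  apply: exec_seq (exec_assign _ _ _) _.
  apply: exec_seq e2 _; exact: exec_assign.
- by rewrite /=; lia.
- by rewrite /= v2 upd.
- by move=> i ib; rewrite update_neq ?f2 //; lia.
Qed.

End Recursion.

Lemma run_rec st cb x y t :
  task st cb (CTask x) y t -> run (prec st cb) x y (t + 20).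
Proof. by move=> H b s sb; apply: exec_rec H sb _. Qed.

(** * Given programs as subroutines *)

Fixpoint shift_expr (b : nat) (e : expr) : expr :=
  match e with
  | EVar i => EVar (b + i)
  | ENil => ENil
  | ECons e1 e2 => ECons (shift_expr b e1) (shift_expr b e2)
  | EHd e1 => EHd (shift_expr b e1)
  | ETl e1 => ETl (shift_expr b e1)
  end.

Fixpoint shift_cmd (b : nat) (c : cmd) : cmd :=
  match c with
  | Assign x e => Assign (b + x) (shift_expr b e)
  | Seq c1 c2 => Seq (shift_cmd b c1) (shift_cmd b c2)
  | If e c1 c2 => If (shift_expr b e) (shift_cmd b c1) (shift_cmd b c2)
  | While e c1 => While (shift_expr b e) (shift_cmd b c1)
  end.

Fixpoint expr_vars (e : expr) : nat :=
  match e with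
  | EVar i => i.+1
  | ENil => 0
  | ECons e1 e2 => maxn (expr_vars e1) (expr_vars e2)
  | EHd e1 | ETl e1 => expr_vars e1
  end.

Fixpoint cmd_vars (c : cmd) : nat :=
  match c with
  | Assign x e => maxn x.+1 (expr_vars e)
  | Seq c1 c2 => maxn (cmd_vars c1) (cmd_vars c2)
  | If e c1 c2 => maxn (expr_vars e) (maxn (cmd_vars c1) (cmd_vars c2))
  | While e c1 => maxn (expr_vars e) (cmd_vars c1)
  end.

Lemma eval_shift b M (s s1 : store) e : expr_vars e <= M ->
  (forall i, i < M -> s1 (b + i) = s i) -> eval s1 (shift_expr b e) = eval s e.
Proof.
move=> le H; elim: e le => //= [e1 I1 e2 I2|e1 I1 /I1 ->|e1 I1 /I1 ->] //.
by rewrite geq_max => /andP [/I1 -> /I2 ->].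
Qed.

Lemma cost_shift b e : expr_cost (shift_expr b e) = expr_cost e.
Proof. by elim: e => //= [e1 -> e2 ->|e1 ->|e1 ->]. Qed.

Lemma exec_shift b M c s s' t : exec c s s' t -> cmd_vars c <= M ->
  forall s1 : store, (forall i, i < M -> s1 (b + i) = s i) ->
  exists2 s1', exec (shift_cmd b c) s1 s1' t &
    (forall i, i < M -> s1' (b + i) = s' i) /\ (forall i, i < b -> s1' i = s1 i).
Proof.
elim=> {c s s' t} /=.
- move=> x e s; rewrite geq_max => /andP [xM eM] s1 H.
  exists (update s1 (b + x) (eval s e)).
    by rewrite -(cost_shift b) -(eval_shift eM H); apply: exec_assign.
  split=> i iM; last by rewrite update_neq //; lia.
  by rewrite /update eqn_add2l; case: ifP => // _; apply: H.
- move=> c1 c2 s s1 s2 t1 t2 _ I1 _ I2; rewrite geq_max => /andP [M1 M2] z H.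
  have [z1 e1 [H1 f1]] := I1 M1 z H; have [z2 e2 [H2 f2]] := I2 M2 z1 H1.
  exists z2; first exact: exec_seq e1 e2.
  by split=> // i ib; rewrite f2 // f1.
- move=> e c1 c2 s s1 t ne _ I1; rewrite !geq_max => /and3P [M0 M1 M2] z H.
  have [z1 e1 H1] := I1 M1 z H; exists z1 => //.
  by rewrite -(cost_shift b); apply: exec_if_true; rewrite // (eval_shift M0 H).
- move=> e c1 c2 s s1 t ne _ I1; rewrite !geq_max => /and3P [M0 M1 M2] z H.
  have [z1 e1 H1] := I1 M2 z H; exists z1 => //.
  by rewrite -(cost_shift b); apply: exec_if_false; rewrite // (eval_shift M0 H).
- move=> e c s s1 s2 t1 t2 ne _ I1 _ I2 M0 z H.
  move: (M0); rewrite geq_max => /andP [Me Mc].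
  have [z1 e1 [H1 f1]] := I1 Mc z H; have [z2 e2 [H2 f2]] := I2 M0 z1 H1.
  exists z2; last by split=> // i ib; rewrite f2 // f1.
  by rewrite -(cost_shift b); apply: exec_while_true e1 e2; rewrite (eval_shift Me H).
- move=> e c s ne; rewrite geq_max => /andP [Me Mc] z H.
  exists z; last by split.
  by rewrite -(cost_shift b); apply: exec_while_false; rewrite (eval_shift Me H).
Qed.

(** A given program expects nil in every variable but its input, whereas registers above the base
    may be dirty. [Assign b (EVar b)] plays the part of a skip command. *)
Fixpoint clear (b m : nat) : cmd :=
  if m is m'.+1 then Seq (Assign (b + m) ENil) (clear b m') else Assign b (EVar b).

Lemma exec_clear b m s : exists2 s', exec (clear b m) s s' (m.+1 * 2) &
  s' b = s b /\ (forall i, 0 < i <= m -> s' (b + i) = Nil) /\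
  (forall i, (i < b) || (b + m < i) -> s' i = s i).
Proof.
elim: m s => [|m IH] s.
  exists (update s b (s b)); first exact: exec_assign.
  split; first by rewrite update_eq.
  split=> [i|i ib]; first lia.
  by rewrite update_neq //; lia.
have [s' e [h1 [h2 h3]]] := IH (update s (b + m.+1) Nil).
exists s'; last split; last split.
- by rewrite mulSn; apply: exec_seq e; apply: exec_assign.
- by rewrite h1 update_neq //; lia.
- move=> i /andP [i0]; rewrite leq_eqVlt => /orP [/eqP ->|im].
    by rewrite h3 ?update_eq //; lia.
  by apply: h2; lia.
- by move=> i ib; rewrite h3 ?update_neq //; lia.
Qed.

Definition pprog (c : cmd) : prog := fun b =>
  Seq (clear b (cmd_vars c)) (shift_cmd b c).

Lemma run_prog c x y t :
  runs c x y t -> run (pprog c) x y (t + (cmd_vars c).+1 * 2).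
Proof.
move=> [s0 e0 s0y] b s sb; set M := cmd_vars c.
have [s1 e1 [h1 [h2 h3]]] := exec_clear b M s.
have [|s2 e2 [h4 h5]] := exec_shift (M := M.+1) (b := b) e0 (leqnSn _) (s1 := s1).
  move=> i iM; rewrite /update; case: eqP => [->|ni]; first by rewrite addn0 h1.
  by apply: h2; lia.
exists s2, (M.+1 * 2 + t); split; [exact: exec_seq e1 e2|lia| |].
- by have := h4 0 isT; rewrite addn0 => ->.
- by move=> i ib; rewrite h5 // h3 // ib.
Qed.

(** * List programs *)

Definition args (l : seq tree) : tree := foldr Cons Nil l.
Definition eargs (l : seq expr) : expr := foldr ECons ENil l.
Definition ebool (c : bool) : expr := if c then ECons ENil ENil else ENil.

(** Linear recursion is a node whose second subtask is the trivial value nil. The combiner sees the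
    two results followed by the context, so the context starts at [EVar 2]. *)
Definition papp : prog := prec
  (pif (EVar 0)
    (pret (EN (eargs [:: EHd (EVar 0)])
              (EC (eargs [:: ETl (EVar 0); EVar 1])) (EV ENil)))
    (pret (EV (EVar 1))))
  (pret (ECons (EVar 2) (EVar 0))).

Lemma run_app T (e : T -> tree) (a b : seq T) :
  run papp (args [:: enc_seq e a; enc_seq e b]) (enc_seq e (a ++ b))
    (300 * (size a).+1).
Proof.
apply: (@run_le _ _ _ (250 * (size a).+1 + 20)); last lia.
apply: run_rec; elim: a => [|h a IH].
  apply: task_le.
    by apply: task_call (task_val _ _ _); apply: run_if_false => //; apply: run_ret.
  by [].
apply: task_le.
  apply: task_call; first by apply: run_if_true => //; apply: run_ret.
  by apply: task_node IH (task_val _ _ _) _; apply: run_ret.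
by rewrite /=; lia.
Qed.

(* Prepends as many copies of the second argument to the first as the third
   has entries. *)
Definition prep : prog := prec
  (pif (EVar 2)
    (pret (EN (eargs [:: EVar 1])
              (EC (eargs [:: EVar 0; EVar 1; ETl (EVar 2)])) (EV ENil)))
    (pret (EV (EVar 0))))
  (pcall (eargs [:: EVar 2; EVar 0]) papp).

Lemma run_rep T T' (e : T -> tree) (e' : T' -> tree) (a z : seq T) (s : seq T') :
  run prep (args [:: enc_seq e a; enc_seq e z; enc_seq e' s])
    (enc_seq e (flatten (nseq (size s) z) ++ a))
    ((size s).+1 * (300 * (size z).+1 + 300)).
Proof.
apply: (@run_le _ _ _ ((size s).+1 * (300 * (size z).+1 + 280) + 20)); last lia.
apply: run_rec; elim: s => [|h s IH].
  apply: task_le.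
    by apply: task_call (task_val _ _ _); apply: run_if_false => //; apply: run_ret.
  by rewrite /=; lia.
apply: task_le.
  apply: task_call; first by apply: run_if_true => //; apply: run_ret.
  apply: task_node IH (task_val _ _ _) _; rewrite /= -catA.
  by apply: run_call; apply: run_app.
by rewrite /=; lia.
Qed.

(** * Arithmetic modulo a power of two *)

(** Ripple-carry addition, least significant bit first. The last carry is dropped, which amounts to
    reduction modulo the power of two. *)
Fixpoint adc (c : bool) (a b : seq bool) : seq bool :=
  match a, b with
  | x :: a', y :: b' =>
      x (+) y (+) c :: adc ((x && y) || (c && (x || y))) a' b'
  | _, _ => [::]
  end.

Definition padc_step (r c : bool) : prog :=
  pret (EN (eargs [:: ebool r])
           (EC (eargs [:: ebool c; ETl (EVar 1); ETl (EVar 2)])) (EV ENil)).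

Definition padc : prog := prec
  (pif (EVar 1) (pif (EVar 2)
    (pif (EHd (EVar 1))
      (pif (EHd (EVar 2))
        (pif (EVar 0) (padc_step true true) (padc_step false true))
        (pif (EVar 0) (padc_step false true) (padc_step true false)))
      (pif (EHd (EVar 2))
        (pif (EVar 0) (padc_step false true) (padc_step true false))
        (pif (EVar 0) (padc_step true false) (padc_step false false))))
    (pret (EV ENil))) (pret (EV ENil)))
  (pret (ECons (EVar 2) (EVar 0))).

Ltac branch := first
  [ apply: run_if_true; [by []|] | apply: run_if_false; [by []|] | exact: run_ret ].

Lemma run_adc c a b :
  run padc (args [:: enc_bool c; enc_bits a; enc_bits b]) (enc_bits (adc c a b))
    (300 * (size a).+1).
Proof.
apply: (@run_le _ _ _ (270 * (size a).+1 + 20)); last lia.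
apply: run_rec; elim: a b c => [|x a IH] b c.
  apply: task_le.
    by apply: task_call (task_val _ _ _); do 2! branch.
  by rewrite /=; lia.
case: b => [|y b].
  apply: task_le.
    by apply: task_call (task_val _ _ _); do 3! branch.
  by rewrite /=; lia.
have := IH b ((x && y) || (c && (x || y))) => {}IH.
case: x y c IH => [] [] [] IH;
  (apply: task_le; [apply: task_call; [by do 6! branch|];
    by apply: task_node IH (task_val _ _ _) _; apply: run_ret
    | by rewrite /=; lia]).
Qed.

(* [z] must be the zero of the same width as [b]. *)
Fixpoint mulb (z a b : seq bool) : seq bool :=
  if a is x :: a' then adc false (if x then b else z) (false :: mulb z a' b)
  else z.

Definition pmul : prog := prec
  (pif (EVar 1)
    (pret (EN (eargs [:: EVar 0; EVar 2; EHd (EVar 1)])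
              (EC (eargs [:: EVar 0; ETl (EVar 1); EVar 2])) (EV ENil)))
    (pret (EV (EVar 0))))
  (pif (EVar 4)
    (pcall (eargs [:: ENil; EVar 3; ECons ENil (EVar 0)]) padc)
    (pcall (eargs [:: ENil; EVar 2; ECons ENil (EVar 0)]) padc)).

Lemma run_mul z a b : size z = size b ->
  run pmul (args [:: enc_bits z; enc_bits a; enc_bits b]) (enc_bits (mulb z a b))
    ((size a).+1 * (300 * (size b).+1 + 350)).
Proof.
move=> zb.
apply: (@run_le _ _ _ ((size a).+1 * (300 * (size b).+1 + 330) + 20)); last lia.
apply: run_rec; elim: a => [|x a IH].
  apply: task_le.
    by apply: task_call (task_val _ _ _); do 2! branch.
  by rewrite /=; lia.
apply: task_le.
  apply: task_call; first by do 2! branch.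
  apply: (@task_node _ _ _ _ _ _ _ _ _ _ (300 * (size b).+1 + 50)) IH (task_val _ _ _) _.
  case: x; apply: run_le.
  - by branch; apply: run_call; exact: (@run_adc false b (false :: mulb z a b)).
  - by rewrite /=; lia.
  - by branch; apply: run_call; exact: (@run_adc false z (false :: mulb z a b)).
  - by rewrite /= zb; lia.
by rewrite /=; lia.
Qed.

(** The first list only counts in unary how many low bits to inspect. An exhausted bit string reads
    as zeros, [hd] and [tl] of nil being nil. *)
Definition pany : prog := prec
  (pif (EVar 0)
    (pif (EHd (EVar 1)) (pret (EV (ebool true)))
      (pret (EC (eargs [:: ETl (EVar 0); ETl (EVar 1)]))))
    (pret (EV ENil)))
  (pret ENil).

Lemma run_any T (e : T -> tree) (l : seq T) v :
  run pany (args [:: enc_seq e l; enc_bits v]) (enc_bool (has id (take (size l) v)))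
    (200 * (size l).+1).
Proof.
apply: (@run_le _ _ _ (180 * (size l).+1 + 20)); last lia.
apply: run_rec; elim: l v => [|h l IH] v.
  rewrite take0; apply: task_le.
    by apply: task_call (task_val _ _ _); do 2! branch.
  by rewrite /=; lia.
case: v => [|[] v].
- apply: task_le.
    apply: task_call; last exact: (IH [::]).
    by do 3! branch.
  by rewrite /=; lia.
- apply: task_le.
    apply: task_call; last exact: task_val.
    by do 3! branch.
  by rewrite /=; lia.
- apply: task_le.
    apply: task_call; last exact: IH.
    by do 3! branch.
  by rewrite /=; lia.
Qed.

(** * Tables indexed by the small subsets *)

(* A subset of an [n]-element list is a bit mask of length [n]; [table n m g]
   is the trie holding [g w] for the masks [w] with at most [m] bits set. *)
Definition leaf v := Cons Nil v.
Definition node a b := Cons (enc_nat 1) (Cons a b).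
Definition enode a b := ECons (enat 1) (ECons a b).

Fixpoint table (n m : nat) (g : seq bool -> tree) : tree :=
  if n is n'.+1 then
    node (table n' m (fun w => g (false :: w)))
         (if m is m'.+1 then table n' m' (fun w => g (true :: w)) else Nil)
  else leaf (g [::]).

Fixpoint table_size (n m : nat) : nat :=
  if n is n'.+1 then
    (table_size n' m + (if m is m'.+1 then table_size n' m' else 1)).+1
  else 1.

Lemma table_size_gt0 n m : 0 < table_size n m.
Proof. by case: n. Qed.

Definition pbuild : prog := prec
  (pif (EVar 0)
    (pif (EVar 1)
      (pret (EN ENil
         (EC (eargs [:: ETl (EVar 0); EVar 1; EVar 2]))
         (EC (eargs [:: ETl (EVar 0); ETl (EVar 1); ECons (EHd (EVar 0)) (EVar 2)]))))
      (pret (EN ENil (EC (eargs [:: ETl (EVar 0); EVar 1; EVar 2])) (EV ENil))))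
    (pret (EV (ECons ENil (EVar 2)))))
  (pret (enode (EVar 0) (EVar 1))).

(** The chosen elements pile up in an accumulator; this is why sets are listed as [rev (mask w u)]
    in the algorithm. *)
Lemma run_build T (e : T -> tree) (u s : seq T) m :
  run pbuild (args [:: enc_seq e u; enc_nat m; enc_seq e s])
    (table (size u) m (fun w => enc_seq e (catrev (mask w u) s)))
    (350 * table_size (size u) m).
Proof.
have := table_size_gt0 (size u) m => gt0.
apply: (@run_le _ _ _ (330 * table_size (size u) m + 20)); last lia.
move: gt0 => _; apply: run_rec; elim: u m s => [|x u IH] m s.
  apply: task_le.
    by apply: task_call (task_val _ _ _); do 2! branch.
  by rewrite /=; lia.
case: m => [|m].
  apply: task_le.
    apply: task_call; first by do 3! branch.
    apply: task_node (IH 0 s) (task_val _ _ _) _; exact: run_ret.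
  by rewrite /=; lia.
apply: task_le.
  apply: task_call; first by do 3! branch.
  apply: task_node (IH m.+1 s) (IH m (x :: s)) _; exact: run_ret.
by rewrite /=; lia.
Qed.

Section Tables.
Variable p : prog.

Definition pzip : prog := prec
  (pif (EVar 2)
    (pif (EHd (EVar 2))
      (pret (EN ENil
        (EC (eargs [:: EVar 0; EHd (ETl (EVar 1)); EHd (ETl (EVar 2))]))
        (EC (eargs [:: EVar 0; ETl (ETl (EVar 1)); ETl (ETl (EVar 2))]))))
      (plet (pcall (eargs [:: EVar 0; ETl (EVar 1); ETl (EVar 2)]) p)
            (pret (EV (ECons ENil (EVar 0))))))
    (pret (EV ENil)))
  (pret (enode (EVar 0) (EVar 1))).

(** The second table steers the recursion and may have the smaller bound: [pscan] combines a left
    child of bound [m.+1] with a right child of bound [m]. *)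
Lemma run_zip env n m m' g h k T : m' <= m ->
  (forall w, size w = n -> run p (args [:: env; g w; h w]) (k w) T) ->
  run pzip (args [:: env; table n m g; table n m' h]) (table n m' k)
    ((T + 320) * table_size n m').
Proof.
move=> le H; have := table_size_gt0 n m' => gt0.
apply: (@run_le _ _ _ ((T + 300) * table_size n m' + 20)); last lia.
move: gt0 => _; apply: run_rec; elim: n m m' le g h k H => [|n IH] m m' le g h k H.
  apply: task_le.
    apply: task_call; last exact: task_val.
    do 2! branch; apply: run_let; first by apply: run_call; apply: (H [::]).
    exact: run_ret.
  by rewrite /=; lia.
have H0 w : size w = n ->
    run p (args [:: env; g (false :: w); h (false :: w)]) (k (false :: w)) T.
  by move=> wn; apply: H; rewrite /= wn.
have H1 w : size w = n ->
    run p (args [:: env; g (true :: w); h (true :: w)]) (k (true :: w)) T.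
  by move=> wn; apply: H; rewrite /= wn.
case: m' le => [|m'] le.
  apply: task_le.
    apply: task_call; first by do 3! branch.
    apply: task_node (IH _ _ le _ _ _ H0) _ _; last exact: run_ret.
    apply: task_call (task_val _ _ _); by do 2! branch.
  by rewrite /=; lia.
case: m le => // m le.
apply: task_le.
  apply: task_call; first by do 3! branch.
  apply: task_node (IH _ _ le _ _ _ H0) (IH _ _ _ _ _ _ H1) _; last exact: run_ret.
  by lia.
by rewrite /=; lia.
Qed.

(* Zeta transform, Moebius inversion and closure under supersets, for the
   appropriate [op]. *)
Fixpoint scan V (op : V -> V -> V) (g : seq bool -> V) (w : seq bool) : V :=
  if w is b :: w' then
    let r := scan op (fun v => g (false :: v)) w' in
    if b then op r (scan op (fun v => g (true :: v)) w') else r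
  else g [::].

Definition pscan : prog := prec
  (pif (EVar 1)
    (pif (EHd (EVar 1))
      (pret (EN (eargs [:: EVar 0])
        (EC (eargs [:: EVar 0; EHd (ETl (EVar 1))]))
        (EC (eargs [:: EVar 0; ETl (ETl (EVar 1))]))))
      (pret (EV (EVar 1))))
    (pret (EV ENil)))
  (plet (pcall (eargs [:: EVar 2; EVar 0; EVar 1]) pzip)
    (pret (enode (EVar 1) (EVar 0)))).

Lemma scan_closed V (op : V -> V -> V) (P : V -> Prop) g w :
  (forall x y, P x -> P y -> P (op x y)) ->
  (forall v, size v = size w -> P (g v)) -> P (scan op g w).
Proof.
move=> Pop; elim: w g => [|b w IH] g H /=; first exact: H.
case: b {H} (H : forall v, size v = (size w).+1 -> P (g v)) => H;
  [apply: Pop|]; by apply: IH => v vw; apply: H; rewrite /= vw.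
Qed.

(** Each level of the trie costs one zip of its two children, whence the factor [n.+1]. A scan at
    [w] reads only submasks of [w], so it never leaves the table. [P] is an invariant, such as a bit
    width, on which the running time of [op] depends. *)
Lemma run_scan V (enc : V -> tree) (op : V -> V -> V) (P : V -> Prop) env n m g T :
  (forall x y, P x -> P y -> P (op x y)) ->
  (forall x y, P x -> P y ->
     run p (args [:: env; enc x; enc y]) (enc (op x y)) T) ->
  (forall w, size w = n -> P (g w)) ->
  run pscan (args [:: env; table n m (fun w => enc (g w))])
    (table n m (fun w => enc (scan op g w)))
    ((T + 700) * n.+1 * table_size n m).
Proof.
move=> Pop H Pg; have := table_size_gt0 n m => gt0.
apply: (@run_le _ _ _ ((T + 680) * n.+1 * table_size n m + 20)); last nia.
move: gt0 => _; apply: run_rec; elim: n m g Pg => [|n IH] m g Pg.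
  apply: task_le.
    apply: task_call; last exact: task_val.
    by do 3! branch.
  by rewrite /=; lia.
have P0 w : size w = n -> P (g (false :: w)) by move=> wn; apply: Pg; rewrite /= wn.
have P1 w : size w = n -> P (g (true :: w)) by move=> wn; apply: Pg; rewrite /= wn.
case: m => [|m].
  apply: task_le.
    apply: task_call; first by do 3! branch.
    apply: task_node (IH 0 _ P0) _ _.
      by apply: task_call (task_val _ _ _); do 2! branch.
    apply: run_let; last exact: run_ret.
    apply: run_call; apply: run_rec; apply: task_call (task_val _ _ _).
    by do 2! branch.
  by rewrite /=; nia.
apply: task_le.
  apply: task_call; first by do 3! branch.
  apply: task_node (IH m.+1 _ P0) (IH m _ P1) _.
  apply: run_let; last exact: run_ret.
  apply: run_call; apply: (run_zip _ (m := m.+1) (m' := m)) => // w wn.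
  by apply: H; apply: scan_closed => // v vw; [apply: P0|apply: P1]; rewrite vw.
by rewrite /=; nia.
Qed.

End Tables.

Fixpoint leaves V (n m : nat) (g : seq bool -> V) : seq V :=
  if n is n'.+1 then
    leaves n' m (fun w => g (false :: w)) ++
    (if m is m'.+1 then leaves n' m' (fun w => g (true :: w)) else [::])
  else [:: g [::]].

Lemma size_leaves V n m (g : seq bool -> V) : size (leaves n m g) <= table_size n m.
Proof.
elim: n m g => [|n IH] [|m] g //=; rewrite size_cat /=.
  by rewrite addn0; apply: leq_trans (IH _ _) _; lia.
have := IH m.+1 (fun w => g (false :: w)).
by have := IH m (fun w => g (true :: w)); lia.
Qed.

Lemma mem_leaves (V : eqType) n m (g : seq bool -> V) r :
  reflect (exists w, [/\ size w = n, count id w <= m & r = g w])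
    (r \in leaves n m g).
Proof.
apply: (iffP idP) => [|[w [wn wm ->]]].
- elim: n m g => [|n IH] m g /=.
    by rewrite inE => /eqP ->; exists [::].
  rewrite mem_cat => /orP [/IH [w [wn wm ->]]|].
    by exists (false :: w); rewrite /= wn.
  case: m => // m /IH [w [wn wm ->]].
  by exists (true :: w); rewrite /= wn.
- elim: n w wn m g wm => [|n IH] [|b w] //= wn m g wm; first by rewrite inE.
  case: wn => wn; rewrite mem_cat; case: b wm => wm.
    by case: m wm => // m wm; rewrite (IH w wn m (fun w => g (true :: w))) ?orbT.
  by rewrite (IH w wn m (fun w => g (false :: w))).
Qed.

Definition pflat : prog := prec
  (pif (EVar 0)
    (pif (EHd (EVar 0))
      (pret (EN ENil (EC (eargs [:: EHd (ETl (EVar 0))]))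
                     (EC (eargs [:: ETl (ETl (EVar 0))]))))
      (pret (EV (eargs [:: ETl (EVar 0)]))))
    (pret (EV ENil)))
  (pcall (eargs [:: EVar 0; EVar 1]) papp).

(** The lists appended at any one level have total length at most the table size, whence the factor
    [n.+1]. *)
Lemma run_flat V (enc : V -> tree) n m g :
  run pflat (args [:: table n m (fun w => enc (g w))]) (enc_seq enc (leaves n m g))
    (920 * n.+1 * table_size n m).
Proof.
have := table_size_gt0 n m => gt0.
apply: (@run_le _ _ _ (900 * n.+1 * table_size n m + 20)); last nia.
move: gt0 => _; apply: run_rec; elim: n m g => [|n IH] m g.
  apply: task_le.
    apply: task_call; last exact: task_val.
    by do 3! branch.
  by rewrite /=; lia.
have := size_leaves n m (fun w => g (false :: w)).
case: m => [|m] sl.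
  apply: task_le.
    apply: task_call; first by do 3! branch.
    apply: task_node (IH 0 _) _ _.
      by apply: task_call (task_val _ _ _); do 2! branch.
    apply: run_call; exact: (@run_app _ enc _ [::]).
  by rewrite /=; nia.
apply: task_le.
  apply: task_call; first by do 3! branch.
  apply: task_node (IH m.+1 _) (IH m _) _.
  by apply: run_call; apply: run_app.
by rewrite /=; nia.
Qed.

(** * Values of bit strings *)

Fixpoint bval (a : seq bool) : nat := if a is x :: a' then x + (bval a').*2 else 0.

Lemma size_adc c a b : size a <= size b -> size (adc c a b) = size a.
Proof.
by elim: a b c => [|x a IH] [|y b] c //= ab; rewrite IH.
Qed.

Lemma size_mulb z a b : size z = size b -> size (mulb z a b) = size b.
Proof.
move=> zb; elim: a => //= x a IH; rewrite size_adc; first by case: x.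
by rewrite /= IH; case: x => //; rewrite zb.
Qed.

Lemma bval_adc c a b : size a <= size b ->
  bval (adc c a b) = bval a + bval b + c %[mod 2 ^ size a].
Proof.
elim: a b c => [|x a IH] [|y b] c //= ab; first by rewrite !modn1.
  by rewrite !modn1.
set c' := _ || _; set q := 2 ^ size a.
have := IH b c' ab; rewrite expnS -/q.
set r := bval (adc _ _ _) => /(congr1 (muln 2)) E.
(* Full adder: [x + y + c] is twice the carry [c'] plus the sum bit, so both sides become an even
   number plus the same bit. *)
have -> : x (+) y (+) c + r.*2 = 2 * r + (x (+) y (+) c) by lia.
have -> : x + (bval a).*2 + (y + (bval b).*2) + c =
   2 * (bval a + bval b + c') + (x (+) y (+) c).
  by rewrite /c'; case: x y c {c' E r} => [] [] [] /=; lia.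
by rewrite -modnDml -[in RHS]modnDml -!muln_modr E.
Qed.

Lemma bval_mulb z a b : size z = size b -> bval z = 0 ->
  bval (mulb z a b) = bval a * bval b %[mod 2 ^ size b].
Proof.
move=> zb z0; elim: a => [|x a IH] /=; first by rewrite z0.
have sx : size (if x then b else z) = size b by case: x.
have := @bval_adc false (if x then b else z) (false :: mulb z a b).
rewrite sx => -> /=; last by rewrite size_mulb.
rewrite addn0 add0n -mul2n -modnDmr -modnMmr IH modnMmr modnDmr.
by congr (_ %% _); case: x {sx}; rewrite ?z0 /=; lia.
Qed.

Lemma bval_nseq_false n : bval (nseq n false) = 0.
Proof. by elim: n => //= n ->. Qed.

Lemma bval_nseq_true n : (bval (nseq n true)).+1 = 2 ^ n.
Proof. by elim: n => //= n; rewrite expnS; lia. Qed.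

Lemma bval_shift n a : bval (nseq n false ++ a) = 2 ^ n * bval a.
Proof. by elim: n => //= [|n ->]; rewrite ?expnS; lia. Qed.

Lemma has_take_bval l a : has id (take l a) = (bval a %% 2 ^ l != 0).
Proof.
elim: l a => [|l IH] a; first by rewrite take0 modn1.
case: a => [|x a] /=; first by rewrite mod0n.
rewrite IH expnS -mul2n; case: x => /=.
  by have := divn_eq (1 + 2 * bval a) (2 * 2 ^ l); lia.
by rewrite add0n -muln_modr; lia.
Qed.

(** * Bit strings of width [L] as residues modulo [2 ^ L] *)

Section Residues.
Local Open Scope ring_scope.
Import GRing.Theory.
Variables (L : nat) (Lgt0 : (0 < L)%N).

Definition residue (a : seq bool) : 'Z_(2 ^ L) := (bval a)%:R.

(** The type ['Z_p] always has at least two elements, so it is the ring of residues modulo [p] only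
    for [p > 1]. *)
Let two_gt1 : (1 < 2 ^ L)%N.
Proof. by rewrite -{1}(expn0 2) ltn_exp2l. Qed.

Lemma natr_mod (x y : nat) : x = y %[mod 2 ^ L] -> x%:R = y%:R :> 'Z_(2 ^ L).
Proof. by move=> e; rewrite -(Zp_nat_mod two_gt1 x) e Zp_nat_mod. Qed.

Lemma residue_nat (a : seq bool) (x : nat) :
  residue a = x%:R -> bval a = x %[mod 2 ^ L].
Proof.
by move/(congr1 val); rewrite /residue /= !val_Zp_nat.
Qed.

Lemma residue_add a b : size a = L -> size b = L ->
  residue (adc false a b) = residue a + residue b.
Proof.
move=> aL bL; rewrite /residue -natrD; apply: natr_mod.
by have := @bval_adc false a b; rewrite aL bL addn0 => ->.
Qed.

Lemma residue_mul z a b : size z = L -> bval z = 0%N -> size b = L ->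
  residue (mulb z a b) = residue a * residue b.
Proof.
move=> zL z0 bL; rewrite /residue -natrM; apply: natr_mod.
by have := @bval_mulb z a b; rewrite zL bL => ->.
Qed.

(** Lets [psub] subtract with the existing multiplier and adder instead of a borrow circuit. *)
Lemma residue_ones : residue (nseq L true) = -1.
Proof.
apply/eqP; rewrite -addr_eq0 /residue -[1]/(1%:R) -natrD addn1 bval_nseq_true.
by rewrite pchar_Zp.
Qed.

End Residues.

(** * Scans under homomorphisms, and Moebius inversion *)

Section ScanTheory.
Local Open Scope ring_scope.
Import GRing.Theory.

Lemma eq_scan V (op : V -> V -> V) g h w :
  (forall v, size v = size w -> g v = h v) -> scan op g w = scan op h w.
Proof.
elim: w g h => [|b w IH] g h H /=; first exact: H.
have H' c v : size v = size w -> g (c :: v) = h (c :: v).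
  by move=> vw; apply: H; rewrite /= vw.
by rewrite (IH _ _ (H' false)) (IH _ _ (H' true)).
Qed.

(** Carries a scan of bit strings over to a scan in a ring. [P] is there because [residue] respects
    addition only on strings of width [L]. *)
Lemma scan_morph V V' (f : V -> V') op op' (P : V -> Prop) g w :
  (forall x y, P x -> P y -> P (op x y)) ->
  (forall x y, P x -> P y -> f (op x y) = op' (f x) (f y)) ->
  (forall v, size v = size w -> P (g v)) ->
  f (scan op g w) = scan op' (fun v => f (g v)) w.
Proof.
move=> Pop fop; elim: w g => [|b w IH] g Pg //=.
have P' c v : size v = size w -> P (g (c :: v)).
  by move=> vw; apply: Pg; rewrite /= vw.
rewrite -(IH _ (P' false)) -(IH _ (P' true)); case: b {Pg} => //.
by rewrite fop //; apply: scan_closed => // v; apply: P'.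
Qed.

Lemma scan_subD (R : zmodType) (g h : seq bool -> R) w :
  scan (fun x y => y - x) (fun v => g v + h v) w =
  scan (fun x y => y - x) g w + scan (fun x y => y - x) h w.
Proof.
elim: w g h => //= b w IH g h; rewrite !IH; case: b => //.
by rewrite opprD addrACA.
Qed.

(** At a set bit the inner transform is the sum of its two halves; by additivity, subtracting the
    first half leaves the second. *)
Lemma scan_inversion (R : zmodType) (g : seq bool -> R) w :
  scan (fun x y => y - x) (scan +%R g) w = g w.
Proof.
elim: w g => //= b w IH g; rewrite IH; case: b => //.
rewrite scan_subD IH.
by rewrite (IH (fun v => g (true :: v))) addrC addKr.
Qed.
End ScanTheory.

(** * Counting covers by total size *)

(* Coefficients of the generating function of the pairs of sets with union
   [w], where [q] marks every element covered twice: for [q = 0] only the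
   partitions remain. *)
Fixpoint cup (q : nat) (f g : seq bool -> nat) (w : seq bool) : nat :=
  if w is b :: w' then
    let f0 v := f (false :: v) in let f1 v := f (true :: v) in
    let g0 v := g (false :: v) in let g1 v := g (true :: v) in
    if b then cup q f1 g0 w' + cup q f0 g1 w' + q * cup q f1 g1 w'
    else cup q f0 g0 w'
  else f [::] * g [::].

Fixpoint cups (q : nat) (f : seq bool -> nat) (k : nat) : seq bool -> nat :=
  if k is k'.+1 then cup q f (cups q f k') else fun w => ~~ has id w.

Section Zeta.
Variable q : nat.

Definition zeta (f : seq bool -> nat) := scan addn (fun v => q ^ count id v * f v).

Lemma zeta_false f w : zeta f (false :: w) = zeta (fun v => f (false :: v)) w.
Proof. by []. Qed.

Lemma scan_mull c (g : seq bool -> nat) w :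
  scan addn (fun v => c * g v) w = c * scan addn g w.
Proof. by elim: w g => //= b w IH g; rewrite !IH; case: b => //; rewrite mulnDr. Qed.

Lemma scan_addn (g h : seq bool -> nat) w :
  scan addn (fun v => g v + h v) w = scan addn g w + scan addn h w.
Proof. by elim: w g h => //= b w IH g h; rewrite !IH; case: b => //; rewrite addnACA. Qed.

Lemma zeta_true f w : zeta f (true :: w) =
  zeta (fun v => f (false :: v)) w + q * zeta (fun v => f (true :: v)) w.
Proof.
rewrite /zeta /= -scan_mull; congr (_ + _); apply: eq_scan => v _.
by rewrite expnS mulnA.
Qed.

Lemma zeta_mull c f w : zeta (fun v => c * f v) w = c * zeta f w.
Proof. by rewrite -scan_mull; apply: eq_scan => v _; rewrite mulnCA. Qed.

Lemma zetaD f g w : zeta (fun v => f v + g v) w = zeta f w + zeta g w.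
Proof. by rewrite -scan_addn; apply: eq_scan => v _; rewrite mulnDr. Qed.

(** Since |A| + |B| = |A u B| + |A n B|, the factor [q] that [cup] attaches to a doubly covered
    element is exactly the surplus weight of the pair. So the zeta transform turns the covering
    product into a pointwise one. *)
Lemma zeta_cup f g w : zeta (cup q f g) w = zeta f w * zeta g w.
Proof.
elim: w f g => [|b w IH] f g; first by rewrite /zeta /= !mul1n.
case: b; last by rewrite !zeta_false -IH.
rewrite !zeta_true /= IH !zetaD zeta_mull !IH; ring.
Qed.

Lemma zeta_cups f k w : zeta (cups q f k) w = zeta f w ^ k.
Proof.
elim: k => [|k IH]; last by rewrite zeta_cup IH expnS.
elim: w => // b w IH; case: b; last by rewrite zeta_false -[RHS]IH.
rewrite zeta_true -[in LHS]/(cups q f 0) IH.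
suff -> : zeta (fun v => cups q f 0 (true :: v)) w = 0 by rewrite muln0.
rewrite -[RHS](mul0n (zeta f w)) -zeta_mull; apply: eq_scan => v _.
by rewrite /= mul0n.
Qed.

End Zeta.

(** The only term in which [cup q] and [cup 0] differ is a multiple of [q]. *)
Lemma cup_mod q f f' g g' w :
  (forall v, f v = f' v %[mod q]) -> (forall v, g v = g' v %[mod q]) ->
  cup q f g w = cup 0 f' g' w %[mod q].
Proof.
elim: w f f' g g' => [|b w IH] f f' g g' Hf Hg /=.
  by rewrite -modnMm Hf Hg modnMm.
case: b; last by apply: IH => v; [apply: Hf|apply: Hg].
rewrite mul0n addn0 [_ + q * _]addnC mulnC modnMDl -modnDm.
rewrite (IH _ (fun v => f' (true :: v)) _ (fun v => g' (false :: v))) //.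
by rewrite (IH _ (fun v => f' (false :: v)) _ (fun v => g' (true :: v))) // modnDm.
Qed.

Lemma cups_mod q f k w : cups q f k w = cups 0 f k w %[mod q].
Proof. by elim: k w => // k IH w; apply: cup_mod. Qed.

(** For [q = 0] each element of [w] goes to exactly one of the two sets, which leaves at most
    [2 ^ size w] pairs. *)
Lemma leq_cup0 f g a b w : (forall v, size v = size w -> f v <= a) ->
  (forall v, size v = size w -> g v <= b) -> cup 0 f g w <= 2 ^ size w * (a * b).
Proof.
elim: w f g => [|c w IH] f g Hf Hg /=.
  by rewrite mul1n leq_mul ?Hf ?Hg.
have Hf' d v : size v = size w -> f (d :: v) <= a by move=> vw; rewrite Hf /= ?vw.
have Hg' d v : size v = size w -> g (d :: v) <= b by move=> vw; rewrite Hg /= ?vw.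
have H d e := IH _ _ (Hf' d) (Hg' e).
rewrite expnS -mulnA mul2n -addnn; case: c {Hf Hg}; last first.
  by apply: leq_trans (H false false) _; lia.
by rewrite mul0n addn0; apply: leq_add; apply: H.
Qed.

Lemma leq_cups0 f k w : (forall v, f v <= 1) -> cups 0 f k w <= 2 ^ (size w * k).
Proof.
move=> Hf; elim: k w => [|k IH] w; first by rewrite muln0 /=; case: has.
apply: leq_trans (leq_cup0 (a := 1) (b := 2 ^ (size w * k)) _ _) _ => // [v <-|].
  exact: IH.
by rewrite mul1n -expnD mulnS.
Qed.

Lemma mobius_power_test (B k : nat) (f : seq bool -> nat) w :
  (forall v, f v <= 1) -> size w * k < B ->
  ((2 ^ B) ^ count id w * cups (2 ^ B) f k w %% 2 ^ (B * (count id w).+1) != 0) =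
  (0 < cups 0 f k w).
Proof.
move=> Hf lt; rewrite mulnS addnC expnD -expnM -muln_modr muln_eq0 negb_or.
rewrite -lt0n expn_gt0 /= cups_mod modn_small ?lt0n //.
by apply: leq_ltn_trans (leq_cups0 _ _ Hf) _; rewrite ltn_exp2l.
Qed.

(** * Masks and sets *)

Section Masks.
Variable T : eqType.
Implicit Types (A P : pred T) (u : seq T).

Lemma eq_map_notin x u (A P : pred T) : x \notin u ->
  (forall y, y != x -> A y = P y) -> map A u = map P u.
Proof.
move=> xu AP; apply/eq_in_map => y yu; apply: AP.
by apply: contraNneq xu => <-.
Qed.

(** [P] selects the elements that go to the first set. The induction changes it at [x] only, which
    the mask of the tail does not notice because [u] has no duplicates. *)
Lemma cup0_gt0 u A f g : uniq u ->
  0 < cup 0 f g (map A u) <->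
  exists P : pred T, 0 < f (map (fun x => A x && P x) u) /\
                     0 < g (map (fun x => A x && ~~ P x) u).
Proof.
elim: u f g => [|x u IH] f g /=.
  move=> _; rewrite muln_gt0; split=> [/andP [? ?]|[P [-> ->]] //].
  by exists xpred0.
move=> /andP [xu uu]; have [Ax|nAx] := boolP (A x); last first.
  by rewrite IH //; split=> [[P [H1 H2]]|[P [H1 H2]]]; exists P;
    rewrite /= ?(negbTE nAx) in H1 H2 *.
rewrite mul0n addn0 addn_gt0; split=> [/orP [] /IH [] // P [H1 H2]|[P /= []]].
(* The summand in which [x] belongs to the first set; the next case is the one in which it belongs
   to the second. *)
- exists (fun y => (y == x) || P y); rewrite eqxx /=.
  split.
    by rewrite (eq_map_notin (P := fun y => A y && P y) xu) => [|y /negbTE /= -> //].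
  by rewrite (eq_map_notin (P := fun y => A y && ~~ P y) xu) => [|y /negbTE /= -> //].
- exists (fun y => (y != x) && P y); rewrite eqxx /=.
  split.
    by rewrite (eq_map_notin (P := fun y => A y && P y) xu) => [|y /= -> //].
  by rewrite (eq_map_notin (P := fun y => A y && ~~ P y) xu) => [|y /= -> //].
- by case: (P x) => /= H1 H2; apply/orP; [left|right]; apply/IH => //; exists P.
Qed.

Lemma scan_orP u A (g : seq bool -> bool) : uniq u ->
  scan orb g (map A u) <-> exists P : pred T, g (map (fun x => A x && P x) u).
Proof.
elim: u g => [|x u IH] g /=; first by move=> _; split=> [H|[]] //; exists xpred0.
move=> /andP [xu uu]; have [Ax|nAx] := boolP (A x); last first.
  by rewrite IH //; split=> [[P H]|[P H]]; exists P; rewrite /= ?(negbTE nAx) in H *.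
split=> [/orP [] /IH [] // P H|[P /=]].
- exists (fun y => (y != x) && P y); rewrite eqxx /=.
  by rewrite (eq_map_notin (P := fun y => A y && P y) xu) => [|y /= -> //].
- exists (fun y => (y == x) || P y); rewrite eqxx /=.
  by rewrite (eq_map_notin (P := fun y => A y && P y) xu) => [|y /negbTE /= -> //].
- by case: (P x) => /= H; apply/orP; [right|left]; apply/IH => //; exists P.
Qed.

End Masks.

(** * Covers, partitions and packings by recursion on [k], and their counts *)

Section SetSystems.
Local Open Scope fset_scope.
Variable F : {fset {fset bitstring}}.
Implicit Types (X Y S : {fset bitstring}) (k : nat).

Lemma tuple_from_cons k S (T : k.-tuple {fset bitstring}) :
  tuple_from F [tuple of S :: T] <-> S \in F /\ tuple_from F T.
Proof.
split=> [H|[SF H] i].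
  by split=> [|i]; [have := H ord0|have := H (lift ord0 i); rewrite tnthS].
by case: (unliftP ord0 i) => [j|] ->; rewrite ?tnthS ?tnth0.
Qed.

Lemma has_cover0 X : has_cover F 0 X <-> X = fset0.
Proof.
split=> [[T [_ <-]]|->]; first by rewrite big_ord0.
by exists [tuple]; split=> [[]//|]; rewrite big_ord0.
Qed.

Lemma has_coverS k X : has_cover F k.+1 X <->
  exists S Y, [/\ S \in F, has_cover F k Y & X = S `|` Y].
Proof.
split=> [[T [H <-]]|[S [Y [SF [T [H <-]] ->]]]].
  move: H; case/tupleP: T => S T /tuple_from_cons [SF H].
  exists S, (\big[@fsetU _/fset0]_(i < k) tnth T i); split=> //; first by exists T.
  by rewrite big_ord_recl tnth0; under eq_bigr do rewrite tnthS.
exists [tuple of S :: T]; split; first exact/tuple_from_cons.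
by rewrite big_ord_recl tnth0; under eq_bigr do rewrite tnthS.
Qed.

Lemma has_partition0 X : has_partition F 0 X <-> X = fset0.
Proof.
rewrite -has_cover0; split=> [[T [H _]]|[T H]]; first by exists T.
by exists T; split=> //; split=> [[]|[]|[]].
Qed.

Lemma sub_bigfsetU k (T : k.-tuple {fset bitstring}) i :
  tnth T i `<=` \big[@fsetU _/fset0]_(j < k) tnth T j.
Proof. by rewrite (bigD1 i) //= fsubsetUl. Qed.

Lemma bigfsetU_sub k (T : k.-tuple {fset bitstring}) X :
  (forall i, tnth T i `<=` X) -> \big[@fsetU _/fset0]_(j < k) tnth T j `<=` X.
Proof.
move=> H; elim/big_ind: _ => //= A B HA HB; by rewrite fsubUset HA HB.
Qed.

Lemma has_partitionS k X : has_partition F k.+1 X <->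
  exists S, [/\ S \in F, S `<=` X & has_partition F k (X `\` S)].
Proof.
split=> [[T [[_ <-]]]|[S [SF SX [T [[H UT] [_ TX dT]]]]]].
  case/tupleP: T => S T [/tuple_from_cons [SF H] sub dis].
  have dS i : [disjoint S & tnth T i]%fset.
    by have := dis ord0 (lift ord0 i) isT; rewrite tnth0 tnthS.
  have dT i j : i != j -> [disjoint tnth T i & tnth T j]%fset.
    by move=> ij; have := dis (lift ord0 i) (lift ord0 j); rewrite !tnthS; apply.
  exists S; split=> //; first by have := sub ord0; rewrite tnth0.
  (* The other sets are disjoint from [S], so removing [S] from the whole union leaves precisely
     their union. *)
  exists T; have E : \big[@fsetU _/fset0]_(i < k) tnth T i =
     (\big[@fsetU _/fset0]_(i < k.+1) tnth [tuple of S :: T] i) `\` S.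
    rewrite big_ord_recl tnth0; under [in RHS]eq_bigr do rewrite tnthS.
    rewrite fsetDUl fsetDv fset0U; apply/esym/fsetDidPl.
    rewrite fdisjoint_sym; apply/fdisjointP => x xS.
    apply: contraL (xS); elim/big_ind: _ => //= [A B IA IB|i _ xi].
      by rewrite inE => /orP [/IA|/IB].
    by have /fdisjointP/(_ x)/contraL -> := dS i.
  split; first by split.
  split=> // i; rewrite -E; exact: sub_bigfsetU.
have UE : \big[@fsetU _/fset0]_(i < k.+1) tnth [tuple of S :: T] i = X.
  rewrite big_ord_recl tnth0; under eq_bigr do rewrite tnthS.
  by rewrite UT fsetUDl fsetDv fsetD0; apply/fsetUidPr.
exists [tuple of S :: T]; split; first by split=> //; apply/tuple_from_cons.
split; first exact/tuple_from_cons.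
  by move=> i; rewrite -[X in _ `<=` X]UE; apply: sub_bigfsetU.
have dS i : [disjoint S & tnth T i]%fset.
  by rewrite fdisjoint_sym; have := TX i; rewrite fsubsetD => /andP [].
move=> i j; case: (unliftP ord0 i) => [i'|] ->; case: (unliftP ord0 j) => [j'|] ->;
  rewrite ?tnthS ?tnth0 ?eqxx // => ij; last by rewrite fdisjoint_sym.
by apply: dT; apply: contraNneq ij => ->.
Qed.

(** Generalised to subsets of a covered set for the induction: once the first set is cut out of [X],
    the rest lies inside the union of the other sets but need not equal it. *)
Lemma has_cover_sub k X Y : closed_under_subsets F ->
  has_cover F k Y -> X `<=` Y -> has_partition F k X.
Proof.
move=> cl; elim: k X Y => [|k IH] X Y.
  by move=> /has_cover0 ->; rewrite fsubset0 => /eqP ->; apply/has_partition0.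
move=> /has_coverS [S [Z [SF cZ ->]]] XY; apply/has_partitionS.
exists (X `&` S); split; [exact: cl SF (fsubsetIr _ _)|exact: fsubsetIl|].
apply: IH cZ _; apply/fsubsetP => x; rewrite !inE => /andP [xXS xX].
by have := fsubsetP XY x xX; rewrite !inE; move: xXS; rewrite xX /= => /negbTE ->.
Qed.

Lemma has_coverP k X : closed_under_subsets F ->
  has_cover F k X <-> has_partition F k X.
Proof.
move=> cl; split=> [H|[T [H _]]]; last by exists T.
exact: has_cover_sub cl H (fsubset_refl _).
Qed.

Lemma has_packingP k X :
  has_packing F k X <-> exists2 Y, Y `<=` X & has_partition F k Y.
Proof.
split=> [[T [H sub dis]]|[Y YX [T [_ [H sub dis]]]]]; last first.
  by exists T; split=> // i; apply: fsubset_trans (sub i) YX.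
exists (\big[@fsetU _/fset0]_(j < k) tnth T j); first exact: bigfsetU_sub.
by exists T; split; [split|split=> // i; apply: sub_bigfsetU].
Qed.

Variables (U : {fset bitstring}) (u : seq bitstring).
Hypotheses (uU : lists u U) (FU : forall S, S \in F -> S `<=` U).

Definition member_of (w : seq bool) : nat := [fset x in mask w u] \in F.

Lemma mask_mem X : X `<=` U -> [fset x in mask (map (mem X) u) u] = X.
Proof.
move=> /fsubsetP XU; apply/fsetP => x; rewrite !inE -filter_mask mem_filter /=.
by apply: andb_idr => /XU; rewrite uU.2.
Qed.

Lemma cups0_partition k X : X `<=` U ->
  0 < cups 0 member_of k (map (mem X) u) <-> has_partition F k X.
Proof.
elim: k X => [|k IH] X XU.
  rewrite has_partition0 /= lt0b has_map; split=> [/hasPn H|->].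
    apply/eqP; rewrite -fsubset0; apply/fsubsetP => x xX.
    by have := H x; rewrite uU.2 (fsubsetP XU) //= xX => /(_ isT).
  by apply/hasPn.
rewrite cup0_gt0; last exact: uU.1.
rewrite has_partitionS; split=> [[P []]|[S [SF SX pS]]].
  set S := [fset x in X | P x].
  have SX : S `<=` X by apply/fsubsetP => x; rewrite !inE => /andP [].
  rewrite (_ : map _ u = map (mem S) u); last by apply: eq_map => x; rewrite /= !inE.
  rewrite /member_of mask_mem ?lt0b ?(fsubset_trans SX) // => SF.
  rewrite (_ : map _ u = map (mem (X `\` S)) u); last first.
    by apply: eq_map => x; rewrite /= !inE; case: (x \in X); rewrite ?andbT ?andbF.
  move=> /IH pS; exists S; split=> //; apply: pS.
  by apply: fsubset_trans XU; apply: fsubsetDl.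
exists (mem S); split.
  rewrite (_ : map _ u = map (mem S) u).
    by rewrite /member_of mask_mem ?SF ?FU.
  by apply: eq_map => x /=; apply: andb_idl; apply: (fsubsetP SX).
rewrite (_ : map _ u = map (mem (X `\` S)) u); last first.
  by apply: eq_map => x; rewrite /= !inE andbC.
by apply/IH => //; apply: fsubset_trans XU; apply: fsubsetDl.
Qed.

Lemma scan_packing k X : X `<=` U ->
  scan orb (fun w => 0 < cups 0 member_of k w) (map (mem X) u) <->
  has_packing F k X.
Proof.
move=> XU; rewrite scan_orP ?uU.1 // has_packingP; split=> [[P]|[Y YX pY]].
  set S := [fset x in X | P x].
  have SX : S `<=` X by apply/fsubsetP => x; rewrite !inE => /andP [].
  rewrite (_ : map _ u = map (mem S) u); last by apply: eq_map => x; rewrite /= !inE.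
  by move=> /cups0_partition pS; exists S => //; apply: pS; apply: fsubset_trans SX XU.
exists (mem Y); rewrite (_ : map _ u = map (mem Y) u).
  by apply/cups0_partition => //; apply: fsubset_trans YX XU.
by apply: eq_map => x /=; apply: andb_idl; apply: (fsubsetP YX).
Qed.

End SetSystems.

(** * The algorithm *)

Definition field (j : nat) (e : expr) : expr := EHd (iter j ETl e).

Definition padd : prog := pcall (eargs [:: ENil; EVar 1; EVar 2]) padc.

(** Second operand minus first, as [y + (2 ^ L - 1) x]; the environment supplies the zero and the
    string of ones. A scan passes the lower half first, hence this order. *)
Definition psub : prog :=
  plet (pcall (eargs [:: field 0 (EVar 0); field 1 (EVar 0); EVar 1]) pmul)
    (pcall (eargs [:: ENil; EVar 3; EVar 0]) padc).

Definition por : prog := pif (EVar 1) (pret (ebool true)) (pret (EVar 2)).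

(** The weight [q ^ |S|] is [one] shifted by [B] places for each listed element. Adding the zero of
    width [L] cuts the string back to that width. *)
Definition pmember (PM : cmd) : prog :=
  plet (pcall (ECons (field 0 (EVar 0)) (ECons (field 1 (EVar 0)) (EVar 1))) (pprog PM))
  (pif (EVar 0)
    (plet (pcall (eargs [:: field 4 (EVar 1); field 2 (EVar 1); EVar 2]) prep)
      (pcall (eargs [:: ENil; field 3 (EVar 2); EVar 0]) padc))
    (pret (field 3 (EVar 1)))).

(** Builds a string of [B (|X| + 1)] bits that serves only as a unary length: the residue modulo
    [q ^ (|X| + 1)] is nonzero iff one of that many low bits is set. *)
Definition ptest : prog :=
  plet (pcall (eargs [:: EVar 0; EVar 0; EVar 1]) prep)
    (pcall (eargs [:: EVar 0; EVar 3]) pany).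

Definition ppair : prog := pret (ECons (EVar 1) (EVar 2)).

(** The partition bit is written twice, since it also answers the cover question for families closed
    under subsets. *)
Definition prow : prog :=
  pret (ECons (EVar 0) (ECons (EVar 1) (ECons (EHd (EVar 2)) (EVar 2)))).

(** The state lists the remaining rounds, [k], the table of [k]-th powers, the output so far, the
    zeta table, the table of sets, and the strings [zL], [zB] and [ones]. Eight lets later all these
    indices have grown by 8. *)
Definition ploop : prog := prec
  (pif (EVar 0)
    (plet (pcall (eargs [:: eargs [:: EVar 6; EVar 8]; EVar 2]) (pscan psub))
    (plet (pcall (eargs [:: EVar 8; EVar 6; EVar 0]) (pzip ptest))
    (plet (pcall (eargs [:: ENil; EVar 0]) (pscan por))
    (plet (pcall (eargs [:: ENil; EVar 1; EVar 0]) (pzip ppair))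
    (plet (pcall (eargs [:: EVar 5; EVar 9; EVar 0]) (pzip prow))
    (plet (pcall (eargs [:: EVar 0]) pflat)
    (plet (pcall (eargs [:: EVar 0; EVar 9]) papp)
    (plet (pcall (eargs [:: EVar 13; EVar 9; EVar 11]) (pzip pmul))
    (pret (EC (eargs [:: ETl (EVar 8); ECons ENil (EVar 9); EVar 0; EVar 1;
                         EVar 12; EVar 13; EVar 14; EVar 15; EVar 16]))))))))))) 
    (pret (EV (EVar 3))))
  (pret ENil).

Definition pinput : prog := fun b =>
  Assign b (ECons (EHd (EVar b)) (ECons (ETl (EVar b)) ENil)).

(** The numbers [n + 1], [B] and [L] are computed in unary, as all-false strings, by repetition; the
    strings of lengths [B] and [L] then double as shifts and zeros. *)
Definition pmain (PU PM : cmd) : prog :=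
  pthen pinput
 (plet (pcall (EVar 0) (pprog PU))
 (plet (pcall (eargs [:: ENil; eargs [:: ENil]; ECons ENil (EVar 0)]) prep)
 (plet (pcall (eargs [:: ENil; EVar 0; EVar 0]) prep)
 (plet (pcall (eargs [:: ENil; EVar 0; EVar 1]) prep)
 (plet (pcall (eargs [:: ENil; eargs [:: ebool true]; EVar 0]) prep)
 (plet (pret (ECons (ebool true) (ETl (EVar 1))))
 (plet (pcall (eargs [:: EVar 5; EVar 7; ENil]) pbuild)
 (plet (pcall (eargs [:: eargs [:: EVar 7; EVar 6; EVar 4; EVar 3; EVar 1];
                         EVar 0; EVar 0]) (pzip (pmember PM)))
 (plet (pcall (eargs [:: ENil; EVar 0]) (pscan padd))
 (* The zeroth powers: every leaf receives [one], the table of sets merely giving the shape. *)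
 (plet (pcall (eargs [:: EVar 3; EVar 2; EVar 2]) (pzip (pret (EVar 0))))
  (* The counter is [m + 1] because [k] runs from 0 to [m] inclusive. *)
  (pcall (eargs [:: ECons ENil (EVar 11); ENil; EVar 0; ENil; EVar 1; EVar 3;
                    EVar 6; EVar 7; EVar 5]) ploop))))))))))).

Lemma run_input a b : run pinput (Cons a b) (args [:: a; b]) 9.
Proof.
move=> r s sr; eexists _, _; split; first exact: exec_assign.
- by [].
- by rewrite /= sr update_eq.
- by move=> i ir; rewrite update_neq //; lia.
Qed.

Lemma flatten_nseq T (x : T) a b : flatten (nseq a (nseq b x)) = nseq (a * b) x.
Proof. by elim: a => //= a ->; rewrite mulSn nseqD. Qed.

(** A cost per unit of [table_size], by which [run_main] multiplies it. One-off costs, such as that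
    of the universe program, are charged at the same rate. *)
Definition total_cost (n m TU TM : nat) : nat :=
  let B := n.+1 * n.+1 in let L := n.+1 * B in
  let add := 300 * L.+1 + 30 in
  let mul := L.+1 * (300 * L.+1 + 350) in
  let sub := mul + add + 50 in
  let rep := n.+2 * (300 * B.+1 + 300) in
  let test := rep + 200 * L.+1 + 100 in
  let iter := (sub + 700) * n.+1 + test + mul + 3000 * n.+1 + 3000 in
  TU + 3 * rep + L.+1 * 900 + (TM + rep + add + 200) + (add + 700) * n.+1 +
  m.+2 * (iter + 200) + 3000.

Section Algorithm.
Variables (PU PM : cmd) (I : bitstring) (u : seq bitstring) (m : nat).
Variables (mem : seq bool -> bool) (TU TM : nat).
Let n := size u.
Variables B L : nat.
Hypotheses (BE : B = n.+1 * n.+1) (LE : L = n.+1 * B).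

Hypothesis run_universe : run (pprog PU) (enc_bits I) (enc_strings u) TU.
Hypothesis run_member : forall w, size w = n ->
  run (pprog PM) (enc_query I u (rev (mask w u))) (enc_bool (mem w)) TM.

Let zB := nseq B false.
Let zL := nseq L false.
Let ones := nseq L true.
Let one := true :: nseq L.-1 false.

Let L_gt0 : 0 < L. Proof. by rewrite LE BE. Qed.
Let size_zL : size zL = L. Proof. by rewrite size_nseq. Qed.
Let size_ones : size ones = L. Proof. by rewrite size_nseq. Qed.
Let size_one : size one = L.
Proof. by rewrite -[size one]/(size (nseq L.-1 false)).+1 size_nseq prednK. Qed.

Definition weight_bits (w : seq bool) : seq bool :=
  if mem w then adc false zL (nseq (size (rev (mask w u)) * B) false ++ one) else zL.
Definition addb_bits := adc false.
Definition sub_bits (a b : seq bool) := adc false b (mulb zL ones a).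
Definition zeta_bits := scan addb_bits weight_bits.
Fixpoint power_bits (k : nat) (w : seq bool) : seq bool :=
  if k is k'.+1 then mulb zL (power_bits k' w) (zeta_bits w) else one.
Definition mobius_bits k := scan sub_bits (power_bits k).
Definition partition_bit k (w : seq bool) : bool :=
  has id (take (size (rev (mask w u)) * B + B) (mobius_bits k w)).
Definition packing_bit k := scan orb (partition_bit k).
Definition row k w : table_row :=
  (k, rev (mask w u), partition_bit k w, partition_bit k w, packing_bit k w).
Fixpoint rows (c k : nat) (out : seq table_row) : seq table_row :=
  if c is c'.+1 then rows c' k.+1 (leaves n m (row k) ++ out) else out.

Lemma size_weight_bits w : size (weight_bits w) = L.
Proof.
rewrite /weight_bits; case: mem; rewrite // size_adc // size_cat size_one size_zL.
exact: leq_addl.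
Qed.

Lemma size_zeta_bits w : size (zeta_bits w) = L.
Proof.
apply: (@scan_closed _ _ (fun x => size x = L)) => [x y xL yL|v _].
  by rewrite size_adc ?xL ?yL.
exact: size_weight_bits.
Qed.

Lemma size_power_bits k w : size (power_bits k w) = L.
Proof.
case: k => [|k]; first exact: size_one.
rewrite -(size_zeta_bits w); apply: size_mulb.
by rewrite size_zeta_bits size_zL.
Qed.

Lemma size_sub_bits a b : size a = L -> size b = L -> size (sub_bits a b) = L.
Proof.
have sm : size a = L -> size (mulb zL ones a) = L.
  by move=> aL; rewrite size_mulb ?aL ?size_zL.
by move=> aL bL; rewrite /sub_bits size_adc ?sm ?bL.
Qed.

Let Tadd := 300 * L.+1 + 30.
Let Tmul := L.+1 * (300 * L.+1 + 350).
Let Tsub := Tmul + Tadd + 50.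
Let Trep := n.+2 * (300 * B.+1 + 300).
Let Tmember := TM + Trep + Tadd + 200.
Let Ttest := Trep + 200 * L.+1 + 100.

Let size_pick w : size w = n -> size (rev (mask w u)) <= n.
Proof. by move=> wn; rewrite size_rev size_mask // -wn count_size. Qed.

Let run_add x y : size x = L -> size y = L ->
  run padd (args [:: Nil; enc_bits x; enc_bits y]) (enc_bits (addb_bits x y)) Tadd.
Proof.
move=> xL yL; apply: run_le; first by apply: run_call; apply: (@run_adc false x y).
by rewrite /= xL /Tadd; lia.
Qed.

Let run_sub x y : size x = L -> size y = L ->
  run psub (args [:: args [:: enc_bits zL; enc_bits ones]; enc_bits x; enc_bits y])
    (enc_bits (sub_bits x y)) Tsub.
Proof.
move=> xL yL; apply: run_le.
  apply: run_let.
    by apply: run_call; apply: (@run_mul zL ones x); rewrite size_zL xL.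
  by apply: run_call; apply: (@run_adc false y (mulb zL ones x)).
by rewrite /= xL yL size_ones /Tsub /Tadd /Tmul; lia.
Qed.

Let run_or x y :
  run por (args [:: Nil; enc_bool x; enc_bool y]) (enc_bool (x || y)) 20.
Proof.
by case: x; apply: run_le; [branch; branch| |branch; branch|].
Qed.

Let run_weight w : size w = n ->
  run (pmember PM)
    (args [:: args [:: enc_bits I; enc_strings u; enc_bits zB; enc_bits zL; enc_bits one];
              enc_strings (rev (mask w u)); enc_strings (rev (mask w u))])
    (enc_bits (weight_bits w)) Tmember.
Proof.
move=> wn; have := size_pick wn => sn.
have := run_member wn; rewrite /weight_bits; case: mem => rm.
  apply: run_le.
    apply: run_let; first by apply: run_call; apply: rm.
    apply: run_if_true => //; apply: run_let.
      by apply: run_call; apply: (@run_rep _ _ enc_bool enc_bits one zB (rev (mask w u))).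
    rewrite flatten_nseq.
    by apply: run_call; apply: (@run_adc false zL).
  rewrite /= size_nseq /Tmember /Trep /Tadd size_zL; move: sn.
  set s := size (rev _) => sn.
  have : s.+1 * (300 * B.+1 + 300) <= n.+2 * (300 * B.+1 + 300).
    by rewrite leq_mul2r ltnS leqW ?orbT.
  by lia.
apply: run_le.
  apply: run_let; first by apply: run_call; apply: rm.
  by apply: run_if_false => //; apply: run_ret.
by rewrite /= /Tmember; lia.
Qed.

Let run_test k w : size w = n ->
  run ptest (args [:: enc_bits zB; enc_strings (rev (mask w u)); enc_bits (mobius_bits k w)])
    (enc_bool (partition_bit k w)) Ttest.
Proof.
move=> wn; have := size_pick wn => sn; rewrite /partition_bit.
set s := size (rev _) in sn *.
have -> : s * B + B = size (flatten (nseq s zB) ++ zB).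
  by rewrite flatten_nseq size_cat !size_nseq.
apply: run_le.
  apply: run_let.
    by apply: run_call; apply: (@run_rep _ _ enc_bool enc_bits zB zB (rev (mask w u))).
  by apply: run_call; apply: run_any.
rewrite /= flatten_nseq size_cat !size_nseq /Ttest /Trep -/s.
have : s.+1 * (300 * B.+1 + 300) <= n.+2 * (300 * B.+1 + 300).
  by rewrite leq_mul2r ltnS leqW ?orbT.
have : s * B + B <= L by rewrite LE mulSn addnC leq_add2l leq_mul2r sn orbT.
by lia.
Qed.

Let S := table_size n m.

Let Titer := (Tsub + 700) * n.+1 + Ttest + Tmul + 3000 * n.+1 + 3000.

Let XT := table n m (fun w => enc_strings (rev (mask w u))).
Let ZT := table n m (fun w => enc_bits (zeta_bits w)).
Let GT k := table n m (fun w => enc_bits (power_bits k w)).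

Let run_loop c k out :
  run ploop (args [:: enc_nat c; enc_nat k; GT k; enc_table out; ZT; XT;
                      enc_bits zL; enc_bits zB; enc_bits ones])
    (enc_table (rows c k out)) (c.+1 * (Titer * S + 200) + 20).
Proof.
apply: run_rec; elim: c k out => [|c IH] k out.
  apply: task_le.
    by apply: task_call (task_val _ _ _); do 2! branch.
  by rewrite /=; lia.
apply: task_le.
  apply: task_call (IH k.+1 (leaves n m (row k) ++ out)).
  branch.
  apply: (@run_let _ _ _ (table n m (fun w => enc_bits (mobius_bits k w)))).
    apply: run_call.
    apply: (@run_scan _ _ enc_bits _ (fun x => size x = L)).
    - exact: size_sub_bits.
    - exact: run_sub.
    - by move=> w _; apply: size_power_bits.
  apply: (@run_let _ _ _ (table n m (fun w => enc_bool (partition_bit k w)))).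
    by apply: run_call; apply: (@run_zip _ _ _ m m) => // w wn; apply: run_test.
  apply: (@run_let _ _ _ (table n m (fun w => enc_bool (packing_bit k w)))).
    apply: run_call.
    apply: (@run_scan _ _ enc_bool orb xpredT) => // x y _ _; exact: run_or.
  apply: (@run_let _ _ _ (table n m (fun w =>
      Cons (enc_bool (partition_bit k w)) (enc_bool (packing_bit k w))))).
    apply: run_call; apply: (@run_zip _ _ _ m m _ _ _ 9) => // w wn.
    by apply: run_ret.
  apply: (@run_let _ _ _ (table n m (fun w => enc_row (row k w)))).
    apply: run_call; apply: (@run_zip _ _ _ m m _ _ _ 20) => // w wn.
    by apply: run_le; first apply: run_ret.
  apply: (@run_let _ _ _ (enc_table (leaves n m (row k)))).
    by apply: run_call; apply: run_flat.
  apply: run_let.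
    by apply: run_call; apply: (@run_app _ enc_row).
  apply: (@run_let _ _ _ (GT k.+1)).
    apply: run_call; apply: (@run_zip _ _ _ m m _ _ _ Tmul) => // w wn.
    apply: run_le; first by apply: run_mul; rewrite size_zeta_bits size_zL.
    by rewrite size_power_bits size_zeta_bits.
  exact: run_ret.
have := size_leaves n m (row k); rewrite -/S; move: (size (leaves _ _ _)) => l lS.
have S0 : 0 < S by apply: table_size_gt0.
have n0 : S <= n.+1 * S by rewrite leq_pmull.
rewrite -/S /= /Titer; move: Tsub Ttest Tmul => a b d; lia.
Qed.


Let run_zeros a b :
  run prep (args [:: Nil; enc_bits (nseq a false); enc_bits (nseq b false)])
  (enc_bits (nseq (b * a) false)) (b.+1 * (300 * a.+1 + 300)).
Proof.
have := @run_rep _ _ enc_bool enc_bool [::] (nseq a false) (nseq b false).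
by rewrite cats0 !size_nseq flatten_nseq.
Qed.

Lemma run_main :
  run (pmain PU PM) (enc_input I m) (enc_table (rows m.+1 0 [::]))
    (total_cost n m TU TM * S).
Proof.
apply: run_le.
  apply: run_then; first exact: run_input.
  apply: run_let; first by apply: run_call; apply: run_universe.
  apply: (@run_let _ _ _ (enc_bits (nseq n.+1 false))).
    apply: run_call.
    have := @run_rep _ _ enc_bool enc_bits [::] (nseq 1 false) ([::] :: u).
    by rewrite cats0 flatten_nseq muln1; apply.
  apply: (@run_let _ _ _ (enc_bits zB)).
    by rewrite /zB BE; apply: run_call; apply: run_zeros.
  apply: (@run_let _ _ _ (enc_bits zL)).
    by rewrite /zL LE; apply: run_call; apply: run_zeros.
  apply: (@run_let _ _ _ (enc_bits ones)).
    apply: run_call.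
    have := @run_rep _ _ enc_bool enc_bool [::] (nseq 1 true) zL.
    by rewrite cats0 flatten_nseq muln1 size_zL; apply.
  apply: (@run_let _ _ _ (enc_bits one)).
    have -> : enc_bits one = Cons (Cons Nil Nil) (tl (enc_bits zL)).
      by rewrite /one /zL -(prednK L_gt0).
    exact: run_ret.
  apply: (@run_let _ _ _ XT).
    apply: run_call; exact: (@run_build _ enc_bits u [::] m).
  apply: (@run_let _ _ _ (table n m (fun w => enc_bits (weight_bits w)))).
    by apply: run_call; apply: (@run_zip _ _ _ m m) => // w wn; apply: run_weight.
  apply: (@run_let _ _ _ ZT).
    apply: run_call; apply: (@run_scan _ _ enc_bits _ (fun x => size x = L)).
    - by move=> x y xL yL; rewrite /addb_bits size_adc ?xL ?yL.
    - exact: run_add.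
    - by move=> w _; apply: size_weight_bits.
  apply: (@run_let _ _ _ (GT 0)).
    by apply: run_call; apply: (@run_zip _ _ _ m m _ _ _ 3) => // w wn; apply: run_ret.
  by apply: run_call; apply: (@run_loop m.+1 0 [::]).
have S0 : 0 < S by apply: table_size_gt0.
have -> : total_cost n m TU TM = TU + 3 * Trep + L.+1 * 900 + Tmember +
    (Tadd + 700) * n.+1 + m.+2 * (Titer + 200) + 3000.
  by rewrite /total_cost /Titer /Tmember /Ttest /Trep /Tsub /Tadd /Tmul LE BE.
have r1 : n.+2 * (300 * n.+2 + 300) <= Trep.
  by rewrite /Trep leq_mul2l leq_add2r leq_mul2l ltnS BE leq_pmull ?orbT.
have r2 : n.+2 * (300 * 2 + 300) <= Trep.
  by rewrite /Trep leq_mul2l leq_add2r leq_mul2l ltnS BE ?orbT.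
have r3 : n.+2 * (300 * B.+1 + 300) = Trep by [].
rewrite -/S -/n /= -/n.
(* The table size [S] is positive, so the one-off costs are at most [S] times themselves. *)
have := leq_pmulr (TU + 3 * Trep + L.+1 * 900 + m.+2 * 200 + 1000) S0.
rewrite r3; move: r1 r2; clear.
move: (n.+2 * (300 * n.+2 + 300)) (n.+2 * (300 * 2 + 300)) => a1 a2.
move: Tadd Tmember Titer Trep S => a b d e s r1 r2; lia.
Qed.

(** The bit computations are followed in the ring of residues modulo [2 ^ L], where the scans can be
    inverted. Only at the end does one return to natural numbers and reduce further, modulo a
    divisor of [2 ^ L]. *)
Lemma partition_bitE k w : size w = n -> k <= n ->
  partition_bit k w = (0 < cups 0 (fun v => mem v : nat) k w).
Proof.
move=> wn kn; set f := fun v => nat_of_bool (mem v).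
have rW v : size v = n ->
    residue L (weight_bits v) = ((2 ^ B) ^ count id v * f v)%:R%R.
  move=> vn; rewrite /weight_bits /f; case: mem; last first.
    by rewrite muln0 /residue bval_nseq_false.
  apply: natr_mod => //.
  have := @bval_adc false zL (nseq (size (rev (mask v u)) * B) false ++ one).
  rewrite size_cat size_one size_zL leq_addl => -> //.
  rewrite bval_nseq_false bval_shift -[bval one]/(1 + (bval (nseq L.-1 false)).*2).
  by rewrite bval_nseq_false size_rev size_mask // -expnM addn0 add0n !muln1 [B * _]mulnC.
have rZ v : size v = n -> residue L (zeta_bits v) = (zeta (2 ^ B) f v)%:R%R.
  move=> vn; rewrite /zeta_bits.
  rewrite (@scan_morph _ _ (residue L) _ +%R%R (fun x => size x = L)).
  - rewrite /zeta (@scan_morph _ _ (fun x => x%:R : 'Z_(2 ^ L))%R _ +%R%R xpredT) //.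
      by apply: eq_scan => x xv; apply: rW; rewrite xv.
    by move=> x y _ _; rewrite GRing.natrD.
  - by move=> x y xL yL; rewrite size_adc ?xL ?yL.
  - by move=> x y xL yL; apply: residue_add.
  - by move=> x _; apply: size_weight_bits.
have rG v : size v = n -> residue L (power_bits k v) =
    scan +%R%R (fun v => ((2 ^ B) ^ count id v * cups (2 ^ B) f k v)%:R)%R v :> 'Z_(2 ^ L).
  (* The table holds pointwise powers; by [zeta_cups] they form the zeta transform of the [k]-fold
     covering product. *)
  move=> vn; transitivity ((zeta (2 ^ B) f v ^ k)%:R : 'Z_(2 ^ L))%R.
    elim: (k) => [|j IH].
      by rewrite /residue -[bval _]/(1 + (bval (nseq L.-1 false)).*2) bval_nseq_false.
    rewrite expnS mulnC GRing.natrM -IH -rZ //; apply: residue_mul => //.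
      exact: bval_nseq_false.
    exact: size_zeta_bits.
  rewrite -zeta_cups /zeta.
  by rewrite (@scan_morph _ _ (fun x => x%:R : 'Z_(2 ^ L))%R _ +%R%R xpredT) // => x y _ _;
    rewrite GRing.natrD.
have rM : residue L (mobius_bits k w) =
    ((2 ^ B) ^ count id w * cups (2 ^ B) f k w)%:R%R.
  rewrite /mobius_bits.
  rewrite (@scan_morph _ _ (residue L) _ (fun x y => y - x)%R (fun x => size x = L)).
  - rewrite -[RHS](@scan_inversion _ (fun w => ((2 ^ B) ^ count id w * cups (2 ^ B) f k w)%:R)%R w).
    by apply: eq_scan => x xw; apply: rG; rewrite xw.
  - exact: size_sub_bits.
  - move=> x y xL yL; rewrite residue_add ?size_mulb ?size_zL //.
    rewrite residue_mul // ?bval_nseq_false // residue_ones //.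
    by rewrite GRing.mulN1r.
  - by move=> x _; apply: size_power_bits.
have kB : size w * k < B by rewrite wn BE ltn_mul // ltnS.
rewrite /partition_bit size_rev size_mask // -(mobius_power_test (B := B)) //; last first.
  by move=> v; rewrite /f; case: mem.
rewrite has_take_bval; have := residue_nat L_gt0 rM => E.
have -> : count id w * B + B = B * (count id w).+1 by lia.
have dv : 2 ^ (B * (count id w).+1) %| 2 ^ L.
  by rewrite dvdn_exp2l // LE mulnC leq_mul2r ltnS -wn count_size orbT.
by rewrite -(modn_dvdm _ dv) E modn_dvdm.
Qed.

Lemma mem_rows c k out r : r \in rows c k out ->
  r \in out \/ exists k' w, [/\ k <= k' < k + c, size w = n, count id w <= m & r = row k' w].
Proof.
elim: c k out => [|c IH] k out /=; first by left.
move=> /IH [|[k' [w [kk wn wm ->]]]]; last first.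
  by right; exists k', w; split=> //; lia.
rewrite mem_cat => /orP [/mem_leaves [w [wn wm ->]]|]; last by left.
by right; exists k, w; split=> //; lia.
Qed.

Lemma rows_mem c k out k' w : k <= k' < k + c -> size w = n -> count id w <= m ->
  row k' w \in rows c k out.
Proof.
move=> kk wn wm.
have sub j i o r : r \in o -> r \in rows j i o.
  by elim: j i o => //= j IH i o ro; apply: IH; rewrite mem_cat ro orbT.
elim: c k out kk => [|c IH] k out kk /=; first lia.
have [->|ne] := eqVneq k' k; last by apply: IH; lia.
apply: sub; rewrite mem_cat; apply/orP; left.
by apply/mem_leaves; exists w.
Qed.

End Algorithm.

(** * Sizes and running times *)

(** The time bound for membership is a polynomial in the size of the query, so the names printed by
    the universe program must be short. Depth bounds the length of every string in a list, and it
    grows at most linearly with time. *)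
Fixpoint depth (d : tree) : nat :=
  if d is Cons a b then (maxn (depth a) (depth b)).+1 else 0.

Lemma depth_size d : depth d <= tree_size d.
Proof. by elim: d => //= a IHa b IHb; lia. Qed.

Lemma depth_eval s D e : (forall x, depth (s x) <= D) ->
  depth (eval s e) <= D + expr_cost e.
Proof.
move=> H; elim: e => //= [x|e1 I1 e2 I2|e1|e1].
- by have := H x; lia.
- by lia.
- by case: (eval s e1) => //= a b; lia.
- by case: (eval s e1) => //= a b; lia.
Qed.

(* Sharing can make the trees built in time [t] exponentially large, but not
   deep. *)
Lemma depth_exec c s s' t D : exec c s s' t -> (forall x, depth (s x) <= D) ->
  forall x, depth (s' x) <= D + t.
Proof.
move=> H; elim: H D => {c s s' t} /=.
- move=> x e s D H y; rewrite /update; case: eqP => _.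
    by have := depth_eval e H; lia.
  by have := H y; lia.
- move=> c1 c2 s s1 s2 t1 t2 _ I1 _ I2 D /I1/I2 H x; have := H x; lia.
- move=> e c1 c2 s s1 t _ _ I1 D /I1 H x; have := H x; lia.
- move=> e c1 c2 s s1 t _ _ I1 D /I1 H x; have := H x; lia.
- move=> e c s s1 s2 t1 t2 _ _ I1 _ I2 D /I1/I2 H x; have := H x; lia.
- move=> e c s _ D H x; have := H x; lia.
Qed.

Lemma depth_runs P x y t : runs P x y t -> depth y <= tree_size x + t.
Proof.
move=> [s e <-]; apply: (depth_exec e) => i.
by rewrite /update; case: eqP => // _; apply: depth_size.
Qed.

Lemma depth_enc_seq T (e : T -> tree) (s : seq T) : size s <= depth (enc_seq e s).
Proof. by elim: s => //= x s IH; lia. Qed.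

Lemma depth_enc_mem (T : eqType) (e : T -> tree) (s : seq T) x :
  x \in s -> depth (e x) <= depth (enc_seq e s).
Proof.
elim: s => //= y s IH; rewrite inE => /orP [/eqP <-|/IH]; lia.
Qed.

Lemma size_enc_bits b : tree_size (enc_bits b) <= 4 * size b + 1.
Proof. by elim: b => //= x b; case: x => /=; lia. Qed.

Lemma size_enc_strings s N : (forall x, x \in s -> size x <= N) ->
  tree_size (enc_strings s) <= size s * (4 * N + 2) + 1.
Proof.
elim: s => //= x s IH H.
have := H x; rewrite mem_head => /(_ isT).
have := size_enc_bits x; rewrite /enc_strings /= -/enc_strings.
have {}IH := IH (fun y ys => H y (mem_behead (s := x :: s) ys)).
by move: IH; rewrite mulSn; lia.
Qed.

(** The recursion of the trie is Pascal's rule. Each leaf accounts for itself, at most [n] nodes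
    above it and at most [n] nil children beside its path, which explains [2 * n + 1]. *)
Lemma leq_table_size n m :
  table_size n m <= (2 * n + 1) * \sum_(0 <= i < m.+1) 'C(n, i).
Proof.
elim: n m => [|n IH] m.
  by rewrite /= mul1n big_nat_recl // bin0 leq_addr.
have gt0 k : 0 < \sum_(0 <= i < k.+1) 'C(n, i).
  by rewrite big_nat_recl // bin0.
have -> : \sum_(0 <= i < m.+1) 'C(n.+1, i) =
    \sum_(0 <= i < m.+1) 'C(n, i) + \sum_(0 <= i < m) 'C(n, i).
  rewrite big_nat_recl // bin0; under eq_bigr do rewrite binS.
  by rewrite big_split /= addnA [in RHS]big_nat_recl // bin0.
have := IH m; have := gt0 m; case: m => [|m] /=.
  by rewrite [\sum_(0 <= i < 0) _]big_geq //; move: (\sum_(_ <= _ < _) _) => a; lia.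
have := IH m; have := gt0 m.
move: (\sum_(0 <= i < m.+2) _) (\sum_(0 <= i < m.+1) _) => a b; nia.
Qed.

(** A predicate on functions, so that a proof can follow the syntax of a cost bound without writing
    the polynomial down. *)
Definition is_poly (f : nat -> nat) := exists p : {poly nat}, forall n, p.[n]%R = f n.

Lemma is_poly_const c : is_poly (fun=> c).
Proof. by exists (c%:P)%R => n; rewrite hornerC. Qed.

Lemma is_poly_id : is_poly (fun n => n).
Proof. by exists 'X%R => n; rewrite hornerX. Qed.

Lemma is_poly_add f g : is_poly f -> is_poly g -> is_poly (fun n => f n + g n).
Proof. by move=> [p Hp] [q Hq]; exists (p + q)%R => n; rewrite hornerD Hp Hq. Qed.

Lemma is_poly_mul f g : is_poly f -> is_poly g -> is_poly (fun n => f n * g n).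
Proof. by move=> [p Hp] [q Hq]; exists (p * q)%R => n; rewrite hornerM Hp Hq. Qed.

Lemma is_poly_succ f : is_poly f -> is_poly (fun n => (f n).+1).
Proof.
move=> [p Hp]; exists (p + 1%:P)%R => n.
by rewrite hornerD hornerC Hp -[(_ + _)%R]/(f n + 1)%N addn1.
Qed.

Lemma is_poly_horner (q : {poly nat}) f : is_poly f -> is_poly (fun n => q.[f n]%R).
Proof. by move=> [p Hp]; exists (q \Po p)%R => n; rewrite horner_comp Hp. Qed.

Ltac is_poly_tac :=
  repeat lazymatch goal with
  | |- is_poly (fun=> ?c) => exact: is_poly_const
  | |- is_poly (fun n => n) => exact: is_poly_id
  | |- is_poly (fun n => @?a n + @?b n) => apply: (@is_poly_add a b)
  | |- is_poly (fun n => @?a n * @?b n) => apply: (@is_poly_mul a b)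
  | |- is_poly (fun n => (@?a n).+1) => apply: (@is_poly_succ a)
  | |- is_poly (fun n => horner ?q (@?a n)) => apply: (@is_poly_horner q a)
  | |- _ => assumption
  end.

(** The coefficients are natural numbers, so every monomial is monotone. *)
Lemma horner_homo (q : {poly nat}) : {homo (fun n => q.[n]%R) : a b / a <= b}.
Proof.
move=> a b ab; rewrite !horner_coef; apply: leq_sum => i _.
by rewrite leq_mul2l; apply/orP; right; elim: (nat_of_ord i) => // j IH;
  rewrite !GRing.exprS leq_mul.
Qed.

Lemma leq_total_cost n n' m m' TU TU' TM TM' :
  n <= n' -> m <= m' -> TU <= TU' -> TM <= TM' ->
  total_cost n m TU TM <= total_cost n' m' TU' TM'.
Proof.
move=> nn mm UU MM; rewrite /total_cost; cbv zeta.
repeat lazymatch goal with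
  | |- is_true (?a <= ?a) => exact: leqnn
  | |- is_true (_ + _ <= _ + _) => apply: leq_add
  | |- is_true (_ * _ <= _ * _) => apply: leq_mul
  | |- is_true (_.+1 <= _.+1) => rewrite ltnS
  | |- _ => assumption
  end.
Qed.

Lemma is_poly_total_cost f g h k : is_poly f -> is_poly g -> is_poly h -> is_poly k ->
  is_poly (fun n => total_cost (f n) (g n) (h n) (k n)).
Proof.
by move=> pf pg ph pk; rewrite /total_cost; cbv zeta; is_poly_tac.
Qed.

(** Recovers a mask from the set it selects. Hence any row of the output about [X] and [k] is the
    one computed at the mask of [X]. *)
Lemma mask_inj_mem (T : eqType) (u : seq T) w : uniq u -> size w = size u ->
  map (fun x => x \in mask w u) u = w.
Proof.
elim: u w => [|x u IH] [|b w] //= /andP [xu uu] [wu].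
have xm : x \notin mask w u by apply: contra xu; apply: mem_mask.
congr cons; first by case: b; rewrite ?mem_head // (negbTE xm).
rewrite -[RHS](IH w) //; apply/eq_in_map => y yu.
by case: b => //=; rewrite inE; case: eqP => // e; rewrite -e yu in xu.
Qed.

(** * Correctness of the output table *)

Section Correctness.
Variables (F : {fset {fset bitstring}}) (U : {fset bitstring}) (u : seq bitstring).
Hypotheses (uU : lists u U) (FU : forall S, S \in F -> (S `<=` U)%fset).
Variables (m B L : nat).
Hypotheses (mu : m <= size u).
Hypotheses (BE : B = (size u).+1 * (size u).+1) (LE : L = (size u).+1 * B).

Let mem w := ([fset x in mask w u] \in F)%fset.
Let T := rows u m mem B L m.+1 0 [::].

Lemma rows_determine k X : k <= m -> (X `<=` U)%fset -> #|` X|%fset <= m ->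
  table_determines F k X T.
Proof.
move=> km XU Xm; set w := map (pred_of_simpl (simpl_of_mem (ssrbool.mem X))) u.
have fm : mask w u = [seq x <- u | x \in X] by rewrite -filter_mask.
have lw : lists (rev (mask w u)) X.
  split; first by rewrite rev_uniq fm filter_uniq ?uU.1.
  move=> x; rewrite mem_rev fm mem_filter; apply: andb_idr => xX.
  by rewrite uU.2 (fsubsetP XU).
have wn : size w = size u by rewrite size_map.
split.
  exists (row u mem B L k w); last by split.
  apply: rows_mem => //.
  rewrite -(size_mask wn) -size_rev.
  by apply: leq_trans Xm; rewrite (perm_size (uniq_perm lw.1 (fset_uniq X) lw.2)).
move=> r /mem_rows [] // [k' [w' [kk w'n w'm ->]]] [? lw']; subst k'.
have {w'm lw' w'n} -> : w' = w.
  rewrite -(mask_inj_mem uU.1 w'n); apply: eq_map => x.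
  by rewrite -mem_rev lw'.2.
have kn : k <= size u by apply: leq_trans km mu.
have pE v : size v = size u ->
    partition_bit u mem B L k v = (0 < cups 0 (member_of F u) k v).
  by move=> vn; apply: partition_bitE.
have part : partition_bit u mem B L k w <-> has_partition F k X.
  by rewrite pE //; apply: cups0_partition XU.
split=> //; first by move=> cl; rewrite has_coverP.
rewrite -(scan_packing uU FU) // /packing_bit -/w.
have -> : scan orb (partition_bit u mem B L k) w =
    scan orb (fun v => 0 < cups 0 (member_of F u) k v) w.
  by apply: eq_scan => v vw; rewrite pE ?vw.
by [].
Qed.
End Correctness.

Theorem theorem3 (R : realType) (Phi : implicit_set_system)
    (Phi_poly : polytime_computable Phi) :
  exists (A : cmd) (p : {poly nat}), forall (I : bitstring) (alpha : R),
    let U := ground (Phi I) in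
    let F := members (Phi I) in
    let n := #|` U|%fset in
    n <= size I -> (0 <= alpha <= 1)%R ->
    exists (T : seq table_row) (t : nat),
      [/\ runs A (enc_input I (threshold n alpha)) (enc_table T) t,
          t <= p.[size I]%R * binomial_sum n alpha &
          forall (k : nat) (X : {fset bitstring}),
            (k%:R <= alpha * n%:R)%R -> (X `<=` U)%fset ->
            (#|` X|%:R <= alpha * n%:R)%R ->
            table_determines F k X T].
Proof.
case: Phi_poly => [[PU [pU HU]] [PM [pM HM]]].
pose x i := 4 * i + 1.
pose tu i := pU.[x i]%R + (cmd_vars PU).+1 * 2.
(* Bounds the size of a query: the instance, and two lists of at most [i] names (since
   [n <= size I]), each of length at most [x i + pU.[x i]] by the depth bound. *)
pose q i := x i + ((i * (4 * (x i + pU.[x i]%R) + 2) + 1) +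
                   (i * (4 * (x i + pU.[x i]%R) + 2) + 1)).+1.+1.
pose tm i := pM.[q i]%R + (cmd_vars PM).+1 * 2.
(* The factor [2 * i + 1] converts the size of the trie into the binomial sum. *)
have [p Hp] : is_poly (fun i => total_cost i i (tu i) (tm i) * (2 * i + 1)).
  apply: (@is_poly_mul _ (fun i => 2 * i + 1)); last by is_poly_tac.
  apply: (@is_poly_total_cost id id tu tm); try exact: is_poly_id.
    by rewrite /tu /x; is_poly_tac.
  by rewrite /tm /q /x; is_poly_tac.
exists (pmain PU PM 0), p => I alpha U F n nI /andP [a0 a1].
have [u [t [uU ru tle]]] := HU I.
have nu : size u = n by apply: perm_size; apply: uniq_perm uU.1 (fset_uniq _) uU.2.
set i := size I in nI *.
have xi : tree_size (enc_bits I) <= x i by apply: size_enc_bits.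
have {}tle : t <= pU.[x i]%R by apply: leq_trans tle (horner_homo _ xi).
have sx s : s \in u -> size s <= x i + pU.[x i]%R.
  move=> su; apply: leq_trans (depth_enc_seq enc_bool s) _.
  apply: leq_trans (depth_enc_mem enc_bits su) _.
  by apply: leq_trans (depth_runs ru) _; apply: leq_add.
set m := threshold n alpha.
have an0 : (0 <= alpha * n%:R)%R by rewrite Num.Theory.mulr_ge0.
(* Comparing a natural number with [alpha * n] is comparing it with the floor [m], so a program
   given [m] in place of [alpha] loses nothing. *)
have thr j : (j%:R <= alpha * n%:R)%R = (j <= m).
  by rewrite /m /threshold Num.Theory.truncn_ge_nat.
(* From [alpha <= 1]. It yields [k <= n], on which the choice of [B] relies. *)
have mn : m <= size u.
  rewrite nu -(@Num.Theory.ler_nat R); apply: Order.PreorderTheory.le_trans (_ : alpha * n%:R <= _)%R.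
    by rewrite thr.
  by rewrite Num.Theory.ler_piMl.
pose mem w := ([fset x in mask w u] \in F)%fset.
have run_member w : size w = size u ->
    run (pprog PM) (enc_query I u (rev (mask w u))) (enc_bool (mem w)) (tm i).
  move=> wu.
  have lw : lists (rev (mask w u)) [fset x in mask w u]%fset.
    split; first by rewrite rev_uniq mask_uniq ?uU.1.
    by move=> y; rewrite mem_rev !inE.
  have [|t' rt' t'le] := HM I [fset x in mask w u]%fset u (rev (mask w u)) uU _ lw.
    by apply/fsubsetP => y; rewrite !inE => /mem_mask; rewrite uU.2.
  apply: run_le (run_prog rt') _; rewrite leq_add2r; apply: leq_trans t'le _.
  apply: horner_homo; rewrite /enc_query /= /q.
  have s1 : tree_size (enc_strings u) <= i * (4 * (x i + pU.[x i]%R) + 2) + 1.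
    apply: leq_trans (size_enc_strings sx) _.
    by rewrite leq_add2r leq_mul2r nu nI orbT.
  have s2 : tree_size (enc_strings (rev (mask w u))) <= i * (4 * (x i + pU.[x i]%R) + 2) + 1.
    have sx' s : s \in rev (mask w u) -> size s <= x i + pU.[x i]%R.
      by rewrite mem_rev => /mem_mask; apply: sx.
    apply: leq_trans (size_enc_strings sx') _.
    rewrite leq_add2r leq_mul2r; apply/orP; right; apply: leq_trans nI.
    by rewrite -nu size_rev size_mask // -wu count_size.
  by lia.
have run_universe : run (pprog PU) (enc_bits I) (enc_strings u) (tu i).
  by apply: run_le (run_prog ru) _; rewrite leq_add2r.
have rm := run_main (m := m) (erefl _) (erefl _) run_universe (mem := mem) run_member.
have [|s [t' [e t'le s0 _]]] := rm 0 (update (fun=> Nil) 0 (enc_input I m)).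
  by rewrite update_eq.
eexists _, t'; split; first by exists s; [exact: e|exact: s0].
  apply: leq_trans t'le _.
  rewrite Hp nu -mulnA; apply: leq_mul.
    by apply: leq_total_cost => //; rewrite -?nu // (leq_trans mn) ?nu.
  apply: leq_trans (leq_table_size _ _) _; apply: leq_mul => //.
  by rewrite leq_add2r leq_mul2l nI.
move=> k X; rewrite !thr => km XU Xm.
by apply: (rows_determine uU) => //; apply: members_sub.
Qed.
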